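(* Let $(\mathbf X^*,\mathbf y^* )\in\mathcal S_n\times\mathcal K$ be an optimal solution (saddle-point) of $\min_{\mathbf X\in\mathcal S_n}\max_{\mathbf y\in\mathcal K}f(\mathbf X,\mathbf y)$. Let $\tilde r$ denote the multiplicity of the smallest eigenvalue $\lambda_n(\nabla_{\mathbf X}f(\mathbf X^*,\mathbf y^* ))$ and for an integer $1\le s\le n-1$ let $\delta(s)=\lambda_{n-s}(\nabla_{\mathbf X}f(\mathbf X^*,\mathbf y^* ))-\lambda_n(\nabla_{\mathbf X}f(\mathbf X^*,\mathbf y^* ))$. Fix an integer $r$ with $\tilde r\le r\le n-1$. Let $\{(\mathbf X_t,\mathbf y_t)\}_{t\ge1}$ and $\{(\mathbf Z_t,\mathbf w_t)\}_{t\ge2}$ be the iterates generated by the projected extragradient method (see context) with fixed step-size $$\eta=\min\left\{\frac{1}{2\sqrt{\beta_X^2+\beta_{yX}^2}},\ \frac{1}{2\sqrt{\beta_y^2+\beta_{Xy}^2}},\ \frac{1}{\beta_X+\beta_{Xy}},\ \frac{1}{\beta_y+\beta_{yX}}\right\}.$$ Assume the initialization satisfies $\|(\mathbf X_1,\mathbf y_1)-(\mathbf X^*,\mathbf y^* )\|\le R_0(r)$, where $$R_0(r):=\frac{\eta}{(1+\sqrt2)\left(1+(2+\sqrt2)\eta\max\{\beta_X,\beta_{Xy}\}\right)}\max\left\{\frac{\sqrt{\tilde r}\,\delta(r-\tilde r+1)}{2},\ \frac{\delta(r)}{1+1/\sqrt{\tilde r}}\right\}.$$ Then for all $t\ge1$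 the projections $\Pi_{\mathcal S_n}[\mathbf X_t-\eta\nabla_{\mathbf X}f(\mathbf X_t,\mathbf y_t)]$ and $\Pi_{\mathcal S_n}[\mathbf X_t-\eta\nabla_{\mathbf X}f(\mathbf Z_{t+1},\mathbf w_{t+1})]$ can be replaced with their rank-$r$ truncated counterparts $\widehat\Pi^r_{\mathcal S_n}[\cdot]$ (applied to the same matrices; see context) without changing the sequences $\{(\mathbf X_t,\mathbf y_t)\}_{t\ge1}$ and $\{(\mathbf Z_t,\mathbf w_t)\}_{t\ge2}$, and for every integer $T\ge1$, $$\max_{\mathbf y\in\mathcal K}f\Big(\frac1T\sum_{t=1}^T\mathbf Z_{t+1},\mathbf y\Big)-\min_{\mathbf X\in\mathcal S_n}f\Big(\mathbf X,\frac1T\sum_{t=1}^T\mathbf w_{t+1}\Big)\le\frac{D^2\max\left\{\sqrt{\beta_X^2+\beta_{yX}^2},\sqrt{\beta_y^2+\beta_{Xy}^2},\tfrac12(\beta_X+\beta_{Xy}),\tfrac12(\beta_y+\beta_{yX})\right\}}{T},$$ where $D:=\sup_{(\mathbf X,\mathbf y),(\mathbf Z,\mathbf w)\in\mathcal S_n\times\mathcal K}\|(\mathbf X,\mathbf y)-(\mathbf Z,\mathbf w)\|$.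
   Context: $\mathbb S^n$ is the space of real symmetric $n\times n$ matrices with inner product $\langle\mathbf A,\mathbf B\rangle=\mathrm{Tr}(\mathbf A\mathbf B)$ and Frobenius norm $\|\cdot\|_F$; $\lambda_i(\mathbf X)$ is the $i$-th largest eigenvalue of $\mathbf X$; $\mathcal S_n=\{\mathbf X\in\mathbb S^n:\mathrm{Tr}(\mathbf X)=1,\mathbf X\succeq0\}$ is the spectrahedron. $\mathbb V$ is a finite-dimensional real Euclidean space with norm $\|\cdot\|_2$, and $\mathcal K\subset\mathbb V$ is nonempty, compact and convex. $\|(\mathbf X,\mathbf y)\|$ is the Euclidean norm on $\mathbb S^n\times\mathbb V$. $\Pi_C$ denotes Euclidean projection onto $C$. $f:\mathbb S^n\times\mathbb V\to\mathbb R$ is differentiable, $f(\cdot,\mathbf y)$ is convex for all $\mathbf y\in\mathcal K$, $f(\mathbf X,\cdot)$ is concave on $\mathcal K$ for all $\mathbf X\in\mathcal S_n$, and $\beta_X,\beta_y,\beta_{Xy},\beta_{yX}\ge0$ are such that for all $\mathbf X,\tilde{\mathbf X}\in\mathcal S_n$, $\mathbf y,\tilde{\mathbf y}\in\mathcal K$: $\|\nabla_{\mathbf X}f(\mathbf X,\mathbf y)-\nabla_{\mathbf X}f(\tilde{\mathbf X},\mathbf y)\|_F\le\beta_X\|\mathbf X-\tilde{\mathbf X}\|_F$, $\|\nabla_{\mathbf y}f(\mathbf X,\mathbf y)-\nabla_{\mathbf y}f(\mathbf X,\tilde{\mathbf y})\|_2\le\beta_y\|\mathbf y-\tilde{\mathbf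 y}\|_2$, $\|\nabla_{\mathbf X}f(\mathbf X,\mathbf y)-\nabla_{\mathbf X}f(\mathbf X,\tilde{\mathbf y})\|_F\le\beta_{Xy}\|\mathbf y-\tilde{\mathbf y}\|_2$, $\|\nabla_{\mathbf y}f(\mathbf X,\mathbf y)-\nabla_{\mathbf y}f(\tilde{\mathbf X},\mathbf y)\|_2\le\beta_{yX}\|\mathbf X-\tilde{\mathbf X}\|_F$. Convention: $1/0=+\infty$, and the $\beta$'s are not all zero, so that $\eta$ is a positive real number. A saddle-point is $(\mathbf X^*,\mathbf y^* )\in\mathcal S_n\times\mathcal K$ with $f(\mathbf X^*,\mathbf y)\le f(\mathbf X^*,\mathbf y^* )\le f(\mathbf X,\mathbf y^* )$ for all $\mathbf X\in\mathcal S_n,\mathbf y\in\mathcal K$. Projected extragradient method with step-size $\eta$: start from $(\mathbf X_1,\mathbf y_1)\in\mathcal S_n\times\mathcal K$ and for $t=1,2,\dots$ set $\mathbf Z_{t+1}=\Pi_{\mathcal S_n}[\mathbf X_t-\eta\nabla_{\mathbf X}f(\mathbf X_t,\mathbf y_t)]$, $\mathbf w_{t+1}=\Pi_{\mathcal K}[\mathbf y_t+\eta\nabla_{\mathbf y}f(\mathbf X_t,\mathbf y_t)]$, $\mathbf X_{t+1}=\Pi_{\mathcal S_n}[\mathbf X_t-\eta\nabla_{\mathbf X}f(\mathbf Z_{t+1},\mathbf w_{t+1})]$, $\mathbf y_{t+1}=\Pi_{\mathcal K}[\mathbf y_t+\eta\nabla_{\mathbf y}f(\mathbf Z_{t+1},\mathbf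 w_{t+1})]$. Rank-$r$ truncated projection: for $\mathbf M\in\mathbb S^n$ with eigen-decomposition $\mathbf M=\sum_{i=1}^n\lambda_i\mathbf v_i\mathbf v_i^\top$, $\lambda_1\ge\dots\ge\lambda_n$, $$\widehat\Pi^r_{\mathcal S_n}[\mathbf M]:=\Pi_{\mathcal S_n}\Big[\sum_{i=1}^r\lambda_i\mathbf v_i\mathbf v_i^\top\Big].$$
   Formalization: The literal rank-r truncation claim is false; here eigenpairs beyond r are discarded and the rest is projected onto the spectrahedron of span(v_1..v_r); the literal version is claimed only when the positive eigenvalues of the projected matrix sum to at least 1. *)

(* Defs.v *)
From HB Require Import structures.
From mathcomp Require Import all_boot all_order all_algebra.
From mathcomp Require Import sesquilinear.
From mathcomp Require Import all_classical all_reals all_analysis.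

Set Implicit Arguments.
Unset Strict Implicit.
Unset Printing Implicit Defensive.

Import Order.TTheory GRing.Theory Num.Theory.
Import numFieldNormedType.Exports.

Local Open Scope classical_set_scope.
Local Open Scope ring_scope.

(* A finite-dimensional real Euclidean space is a normed space V whose norm is
   the one of the inner product dot, and which has a finite spanning family. *)
Definition euclidean_space (R : realType) (V : normedModType R)
    (dot : {dot V for idfun}) : Prop :=
  (forall u : V, `|u| = Num.sqrt (dot u u)) /\
  exists s : seq V, forall u : V,
    exists c : 'I_(size s) -> R, u = \sum_(i < size s) c i *: s`_i.

Definition symmetric_matrices (R : realType) (n : nat) : set 'M[R]_n :=
  [set A | A^T = A].
Arguments symmetric_matrices : clear implicits.

Definition spectrahedron (R : realType) (n : nat) : set 'M[R]_n :=
  [set X | [/\ X^T = X,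
              forall v : 'cV[R]_n, 0 <= (v^T *m X *m v) 0 0
            & \tr X = 1]].
Arguments spectrahedron : clear implicits.

(* The inner product and norm of the space of symmetric matrices; neither is
   used outside of that space. *)
Definition frob_dot (R : realType) (n : nat) (A B : 'M[R]_n) : R :=
  \tr (A *m B).

Definition frob_norm (R : realType) (n : nat) (A : 'M[R]_n) : R :=
  Num.sqrt (frob_dot A A).

Definition pair_norm (R : realType) (n : nat) (V : normedModType R)
    (A : 'M[R]_n) (u : V) : R :=
  Num.sqrt (frob_norm A ^+ 2 + `|u| ^+ 2).

(* f is a function on (symmetric matrices) x V: its values at nonsymmetric
   matrices are irrelevant, hence the restriction to symmetric increments. *)
Definition is_gradient (R : realType) (n : nat) (V : normedModType R)
    (dot : {dot V for idfun}) (f : 'M[R]_n -> V -> R) (A : 'M[R]_n) (u : V)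
    (gA : 'M[R]_n) (gu : V) : Prop :=
  gA^T = gA /\
  forall e : R, 0 < e ->
    \forall h \near (0 : 'M[R]_n * V), h.1^T = h.1 ->
      `|f (A + h.1) (u + h.2) - f A u - (frob_dot gA h.1 + dot gu h.2)|
        <= e * pair_norm h.1 h.2.

Definition saddle_point (R : realType) (n : nat) (V : normedModType R)
    (K : set V) (f : 'M[R]_n -> V -> R) (A : 'M[R]_n) (u : V) : Prop :=
  [/\ spectrahedron R n A, K u,
      forall v, K v -> f A v <= f A u
    & forall B, spectrahedron R n B -> f A u <= f B u].

Definition is_frob_proj (R : realType) (n : nat) (C : set 'M[R]_n)
    (M P : 'M[R]_n) : Prop :=
  C P /\ forall Q, C Q -> frob_norm (M - P) <= frob_norm (M - Q).

Definition is_proj (R : realType) (V : normedModType R) (C : set V)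
    (u p : V) : Prop :=
  C p /\ forall q, C q -> `|u - p| <= `|u - q|.

(* The eigenvalues with multiplicity, in nonincreasing order (they are all real
   when A is symmetric). *)
Definition is_spectrum (R : realType) (n : nat) (A : 'M[R]_n) (s : seq R) :
    Prop :=
  sorted >=%R s /\ char_poly A = \prod_(x <- s) ('X - x%:P).

Definition spectrum (R : realType) (n : nat) (A : 'M[R]_n) : seq R :=
  xget [::] [set s | is_spectrum A s].

(* The index i is 1-based: lambda A 1 is the largest eigenvalue. *)
Definition lambda (R : realType) (n : nat) (A : 'M[R]_n) (i : nat) : R :=
  (spectrum A)`_i.-1.

Definition min_eig_mult (R : realType) (n : nat) (A : 'M[R]_n) : nat :=
  mup (lambda A n) (char_poly A).

Definition eig_gap (R : realType) (n : nat) (A : 'M[R]_n) (s : nat) : R :=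
  lambda A (n - s)%N - lambda A n.

(* M = sum_i d_i v_i v_i^T, where v_i is the i-th column of U. *)
Definition eigen_decomposition (R : realType) (n : nat) (M U : 'M[R]_n)
    (d : 'rV[R]_n) : Prop :=
  [/\ U^T *m U = 1%:M,
      forall i j : 'I_n, (i <= j)%N -> d 0 j <= d 0 i
    & M = \sum_(i < n) d 0 i *: (col i U *m (col i U)^T)].

Definition truncation (R : realType) (n : nat) (r : nat) (U : 'M[R]_n)
    (d : 'rV[R]_n) : 'M[R]_n :=
  \sum_(i < n | (i < r)%N) d 0 i *: (col i U *m (col i U)^T).

(* The matrices of the spectrahedron whose range is included in the span of the
   first r columns of the orthogonal matrix U. *)
Definition spectrahedron_face (R : realType) (n : nat) (r : nat)
    (U : 'M[R]_n) : set 'M[R]_n :=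
  spectrahedron R n `&`
  [set P | forall i : 'I_n, (r <= i)%N -> P *m col i U = 0].

(* P is the rank-r truncated projection of M: the eigenpairs of index > r are
   discarded, and what remains, an operator on the span of v_1, ..., v_r, is
   projected onto the spectrahedron of that span. Equivalently,
     P = sum_(i <= r) max(0, d_i - c) v_i v_i^T
   where c is such that tr P = 1. Ties between eigenvalues are handled by
   requiring this for every eigen-decomposition of M. *)
Definition truncated_proj (R : realType) (n : nat) (r : nat)
    (M P : 'M[R]_n) : Prop :=
  forall (U : 'M[R]_n) (d : 'rV[R]_n), eigen_decomposition M U d ->
    is_frob_proj (spectrahedron_face r U) (truncation r U d) P.

(* Variant in which the discarded eigenpairs become eigenpairs of value 0: the
   truncated matrix is projected onto the whole spectrahedron. It is not
   invariant under M |-> M + a I, contrary to the projection of M, and may put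
   mass outside of the span of v_1, ..., v_r when the positive eigenvalues of M
   sum to less than 1. *)
Definition zero_truncated_proj (R : realType) (n : nat) (r : nat)
    (M P : 'M[R]_n) : Prop :=
  forall (U : 'M[R]_n) (d : 'rV[R]_n), eigen_decomposition M U d ->
    is_frob_proj (spectrahedron R n) (truncation r U d) P.

Definition pos_eig_sum (R : realType) (n : nat) (M : 'M[R]_n) : R :=
  \sum_(x <- spectrum M) Num.max 0 x.

(* Inverses are taken in \bar R, where 0^-1 = +oo. *)
Definition step_size (R : realType) (bX by_ bXy byX : R) : R :=
  fine (Order.min
    (Order.min ((2 * Num.sqrt (bX ^+ 2 + byX ^+ 2))%:E^-1)%E
               ((2 * Num.sqrt (by_ ^+ 2 + bXy ^+ 2))%:E^-1)%E)
    (Order.min ((bX + bXy)%:E^-1)%E ((by_ + byX)%:E^-1)%E)).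

Definition extragradient (R : realType) (n : nat) (V : normedModType R)
    (K : set V) (gX : 'M[R]_n -> V -> 'M[R]_n) (gy : 'M[R]_n -> V -> V)
    (eta : R) (X : nat -> 'M[R]_n) (y : nat -> V)
    (Z : nat -> 'M[R]_n) (w : nat -> V) : Prop :=
  [/\ spectrahedron R n (X 1), K (y 1)
    & forall t, (1 <= t)%N ->
      [/\ is_frob_proj (spectrahedron R n)
            (X t - eta *: gX (X t) (y t)) (Z t.+1),
          is_proj K (y t + eta *: gy (X t) (y t)) (w t.+1),
          is_frob_proj (spectrahedron R n)
            (X t - eta *: gX (Z t.+1) (w t.+1)) (X t.+1)
        & is_proj K (y t + eta *: gy (Z t.+1) (w t.+1)) (y t.+1)]].

Definition init_radius (R : realType) (n : nat) (bX bXy eta : R)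
    (G : 'M[R]_n) (r : nat) : R :=
  let rt := min_eig_mult G in
  eta / ((1 + Num.sqrt 2) *
         (1 + (2 + Num.sqrt 2) * eta * Num.max bX bXy)) *
  Num.max (Num.sqrt rt%:R * eig_gap G (r - rt + 1)%N / 2)
          (eig_gap G r / (1 + 1 / Num.sqrt rt%:R)).

Definition diameter (R : realType) (n : nat) (V : normedModType R)
    (K : set V) : R :=
  sup [set x | exists (A B : 'M[R]_n) (u v : V),
        [/\ spectrahedron R n A, spectrahedron R n B, K u, K v
          & x = pair_norm (A - B) (u - v)]].
Arguments diameter {R} n {V} K.

Definition is_max (R : realType) (A : set R) (m : R) : Prop :=
  A m /\ ubound A m.

Definition is_min (R : realType) (A : set R) (m : R) : Prop :=
  A m /\ lbound A m.

(* Main.v *)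
(* Write z = (X, y) and F(z) = (grad_X f, - grad_y f).  The extragradient step
   gives |z' - q|^2 + |z - u|^2 / 2 + 2 eta <F(u), u - q> <= |z - q|^2 for all
   feasible q.  Summing over t bounds the duality gap of the averages; with q the
   saddle point s, where <F(u), u - s> >= 0, it shows that |z_t - s| does not
   increase and that |u_t - s| <= (1 + sqrt 2) |z_t - s|.

   Hence the projected matrices M stay within eps of X_s - eta G, where
   G = grad_X f(s), s = (X_s, y_s).  The projection of M onto the spectrahedron is
   sum_i max(0, d_i - c) u_i u_i^T, and c >= d_{r+1} if and only if
   sum_{i <= r} (d_i - d_{r+1}) >= 1.  Optimality of X_s puts its range inside the
   eigenspace E of the smallest eigenvalue of G, of dimension r~.  Testing M
   against the projector onto E, and against a projector of rank k (k = 1 or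
   k = r~) onto a space orthogonal to E lying in the span of u_1, ..., u_{r+1},
   yields that inequality as soon as
   eps (sqrt r~ + r~ / sqrt k) <= r~ eta delta(r + 1 - k); these two conditions
   are the two terms of the maximum in R_0(r). *)
Require Import Defs.
From HB Require Import structures.
From mathcomp Require Import all_boot all_order all_algebra.
From mathcomp Require Import sesquilinear.
From mathcomp Require Import all_classical all_reals all_analysis.
From mathcomp Require Import fingroup perm complex spectral lra ring zify.

Set Implicit Arguments.
Unset Strict Implicit.
Unset Printing Implicit Defensive.

Import Order.TTheory GRing.Theory Num.Theory.
Import numFieldNormedType.Exports.

Local Open Scope classical_set_scope.
Local Open Scope ring_scope.

(** * The real spectral theorem *)

(** Over [R[i]] the matrix is Hermitian, so its spectral diagonal is real. The first diagonal entry
    is a root of the characteristic polynomial, and being a root descends along the embedding of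
    [R]. *)
Lemma symmetric_eigenvalue (R : rcfType) (n : nat) (A : 'M[R]_n.+1) :
  A^T = A -> exists a, eigenvalue A a.
Proof.
move=> symA; pose AC := map_mx (real_complex R) A.
have hermAC : AC \is hermsymmx.
  apply: realsym_hermsym.
    apply/is_hermitianmxP; rewrite expr0 scale1r map_mx_id //.
    by rewrite /AC map_trmx symA.
  by apply/mxOverP => i j; rewrite mxE complex_real.
have /orthomx_spectralP ACE := hermitian_normalmx hermAC.
have /mxOverP/(_ 0 0) := hermitian_spectral_diag_real hermAC.
set a := spectral_diag AC 0 0 => areal.
have /complex_realP [b ab] := areal.
suff eigC : eigenvalue AC a.
  exists b; move: eigC; rewrite !eigenvalue_root_char -map_char_poly ab.
  by rewrite fmorph_root.
apply/eigenvalueP; exists (row 0 (spectralmx AC)).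
  rewrite -row_mul [X in _ *m X]ACE.
  rewrite -mulmxA mulKVmx ?spectral_unit //.
  by apply/rowP => j; rewrite row_mul row_diag_mx -scalemxAl -rowE mxE [in RHS]mxE mxE.
have := spectral_unit AC; rewrite -row_free_unit => /row_freeP [B] PB.
apply/eqP => row0.
have /matrixP/(_ 0 0) : row 0 (spectralmx AC *m B) = row 0 1%:M by rewrite PB.
by rewrite row_mul row0 mul0mx !mxE eqxx => /eqP; rewrite eq_sym oner_eq0.
Qed.

(** [H] is the reflection in the hyperplane orthogonal to [w = v - e], or the identity when [w = 0].
    Since [|w|^2 = 2 (1 - v_0)], its usual factor [2 / |w|^2] is [1 / (1 - v_0)]. *)
Lemma householder (R : rcfType) (n : nat) (v : 'cV[R]_n.+1) :
  (v^T *m v) 0 0 = 1 ->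
  exists H : 'M[R]_n.+1, [/\ H^T = H, H *m H = 1%:M & H *m v = delta_mx 0 0].
Proof.
move=> v1; pose e : 'cV[R]_n.+1 := delta_mx 0 0.
have eTe : e^T *m e = 1%:M.
  by rewrite trmx_delta mul_delta_mx; apply/matrixP=> i j; rewrite !mxE !ord1.
have vTv : v^T *m v = 1%:M by apply/matrixP=> i j; rewrite !ord1 v1 mxE.
have vTe : v^T *m e = (v 0 0)%:M.
  by apply/matrixP=> i j; rewrite !ord1 -colE !mxE.
have eTv : e^T *m v = (v 0 0)%:M by rewrite -[LHS]trmxK trmx_mul trmxK vTe tr_scalar_mx.
pose w := v - e.
have wT : w^T = v^T - e^T by rewrite /w linearB.
have wTw : w^T *m w = (2 - 2 * v 0 0)%:M.
  rewrite wT /w mulmxBr !mulmxBl eTe vTv vTe eTv -!raddfB /=.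
  by congr (_%:M); ring.
have wTv : w^T *m v = (1 - v 0 0)%:M.
  by rewrite wT mulmxBl vTv eTv -raddfB.
have [w0|wN0] := eqVneq w 0.
  exists 1%:M; rewrite trmx1 !mul1mx; split=> //.
  by move/eqP: w0; rewrite subr_eq0 => /eqP.
have nz : 1 - v 0 0 != 0.
  apply: contraNneq wN0 => v00; have : (w^T *m w) 0 0 = 0.
    by rewrite wTw !mxE eqxx mulr1n; lra.
  rewrite mxE => /eqP; rewrite psumr_eq0 => [/allP h|i _]; last first.
    by rewrite !mxE -expr2 sqr_ge0.
  apply/eqP/colP => i; have /eqP := h i (mem_index_enum _).
  by rewrite mxE -expr2 => /eqP; rewrite sqrf_eq0 => /eqP ->; rewrite mxE.
exists (1%:M - (1 - v 0 0)^-1 *: (w *m w^T)); split.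
- by rewrite linearB /= trmx1 linearZ /= trmx_mul trmxK.
- rewrite mulmxBl mul1mx mulmxBr mulmx1 -!scalemxAl -!scalemxAr.
  rewrite -mulmxA [w^T *m (_ *m _)]mulmxA wTw mul_scalar_mx -scalemxAr !scalerA.
  set c := ((1 - v 0 0)^-1 * (_ * _)).
  have -> : c = 2 * (1 - v 0 0)^-1 by rewrite /c; field.
  by apply/matrixP=> i j; rewrite !mxE; ring.
- rewrite mulmxBl mul1mx -scalemxAl -mulmxA wTv mul_mx_scalar scalerA mulVf //.
  by rewrite scale1r /w opprB addrC subrK.
Qed.

(** Deflation: a reflection [H] moves a unit eigenvector to the first basis vector. Then [H A H] is
    block diagonal with a symmetric lower block, to which induction applies. *)
Lemma symmetric_diagonalizable (R : rcfType) (n : nat) (A : 'M[R]_n) :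
  A^T = A ->
  exists (U : 'M[R]_n) (d : 'rV[R]_n),
    U^T *m U = 1%:M /\ A = U *m diag_mx d *m U^T.
Proof.
elim: n A => [A _|n IHn A symA].
  by exists 1%:M, 0; split; apply/matrixP=> -[].
have [a /eigenvalueP [v vA vN0]] := symmetric_eigenvalue symA.
have vv0 : 0 < (v *m v^T) 0 0.
  rewrite mxE lt_def; apply/andP; split; last first.
    by apply: sumr_ge0 => i _; rewrite mxE -expr2 sqr_ge0.
  rewrite psumr_neq0 => [|i _]; last by rewrite mxE -expr2 sqr_ge0.
  case/rV0Pn: vN0 => i vi; apply/hasP; exists i; first exact: mem_index_enum.
  by rewrite mxE -expr2 exprn_even_gt0.
pose c := (Num.sqrt ((v *m v^T) 0 0))^-1.
pose u := (c *: v)^T.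
have [|H [symH HH Hu]] := @householder R n u.
  rewrite /u trmxK [(_ *: _)^T]linearZ /= -scalemxAl -scalemxAr.
  rewrite scalerA mxE /c -expr2 exprVn.
  by rewrite sqr_sqrtr ?ltW // mulVf // gt_eqF.
have Au : A *m u = a *: u.
  by rewrite -[A]symA -trmx_mul -scalemxAl vA scalerA mulrC -scalerA linearZ.
pose B : 'M[R]_(1 + n) := H *m A *m H.
have symB : B^T = B by rewrite !trmx_mul symH symA mulmxA.
have Be : B *m delta_mx 0 0 = a *: delta_mx 0 0 :> 'cV_(1 + n).
  by rewrite -Hu -2!mulmxA [H *m (H *m u)]mulmxA HH mul1mx Au -scalemxAr.
have Bi0 i : B i 0 = (i == 0)%:R * a.
  have := congr1 (fun M : 'cV_(1 + n) => M i 0) Be.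
  by rewrite /= -colE !mxE eqxx andbT mulrC.
have ul : ulsubmx B = a%:M.
  apply/matrixP => i j; rewrite !ord1 [RHS]mxE mulr1n.
  by rewrite [LHS]mxE [LHS]mxE lshift0 Bi0 mul1r.
have dl : dlsubmx B = 0.
  apply/matrixP => i j; rewrite !ord1 [RHS]mxE [LHS]mxE [LHS]mxE lshift0 Bi0.
  exact: mul0r.
have ur : ursubmx B = 0 by rewrite -symB -trmx_dlsub dl trmx0.
have [|U' [d' [U'U' B'E]]] := IHn (drsubmx B).
  by rewrite trmx_drsub symB.
pose U1 : 'M[R]_(1 + n) := block_mx 1%:M 0 0 U'.
have U1U1 : U1^T *m U1 = 1%:M.
  rewrite tr_block_mx mulmx_block !trmx1 !trmx0 !mulmx0 !mul0mx !addr0 mulmx1.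
  by rewrite U'U' add0r -scalar_mx_block.
have BE : B = U1 *m diag_mx (row_mx a%:M d') *m U1^T.
  rewrite -[LHS]submxK ul dl ur B'E diag_mx_row /U1 tr_block_mx !mulmx_block.
  congr block_mx; rewrite ?(trmx0, trmx1, mul0mx, mulmx0, add0r, addr0);
    rewrite ?(mul0mx, mulmx0, add0r, addr0, mul1mx, mulmx1) //.
  by apply/matrixP => i j; rewrite !ord1 !mxE eqxx.
exists (H *m U1), (row_mx a%:M d'); split.
  by rewrite trmx_mul symH mulmxA -(mulmxA U1^T) HH mulmx1 U1U1.
rewrite trmx_mul symH -!mulmxA [U1 *m _]mulmxA [X in H *m X]mulmxA -BE /B.
by rewrite !mulmxA HH mul1mx -mulmxA HH mulmx1.
Qed.

(** * Ordered eigen-decompositions, spectra and the multiplicity of the smallest eigenvalue *)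

Section EigenDecomposition.
Variables (R : realType) (n : nat).
Implicit Types (M U Q : 'M[R]_n) (d : 'rV[R]_n).

Lemma sum_col_dyad U d (P : pred 'I_n) :
  \sum_(i < n | P i) d 0 i *: (col i U *m (col i U)^T) =
  U *m diag_mx (\row_i (if P i then d 0 i else 0)) *m U^T.
Proof.
apply/matrixP => a b; rewrite summxE mxE big_mkcond; apply: eq_bigr => k _.
rewrite mul_mx_diag !mxE; case: ifP => _; last by rewrite mulr0 mul0r.
by rewrite big_ord1 !mxE; ring.
Qed.

Lemma truncationE (r : nat) U d :
  truncation r U d =
  U *m diag_mx (\row_i (if (i < r)%N then d 0 i else 0)) *m U^T.
Proof. exact: sum_col_dyad. Qed.

Lemma eigen_decomposition_mul M U d :
  eigen_decomposition M U d -> M = U *m diag_mx d *m U^T.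
Proof.
case=> _ _ ->; rewrite sum_col_dyad; congr (_ *m diag_mx _ *m _).
by apply/rowP => i; rewrite mxE.
Qed.

Lemma mxtrace_diag_conj U d Q :
  \tr (U *m diag_mx d *m U^T *m Q) = \sum_i d 0 i * (U^T *m Q *m U) i i.
Proof.
rewrite -!mulmxA mxtrace_mulC -mulmxA mul_diag_mx.
by apply: eq_bigr => i _; rewrite mxE !mulmxA.
Qed.

Lemma conj_entry_col U Q i : (U^T *m Q *m U) i i = ((col i U)^T *m Q *m col i U) 0 0.
Proof.
rewrite !mxE; apply: eq_bigr => k _; rewrite !mxE; congr (_ * _).
by apply: eq_bigr => l _; rewrite !mxE.
Qed.

Lemma diag_conj_sym U d : (U *m diag_mx d *m U^T)^T = U *m diag_mx d *m U^T.
Proof. by rewrite !trmx_mul trmxK tr_diag_mx mulmxA. Qed.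

Lemma symmetric_eigen_decomposition M :
  M^T = M -> exists U d, eigen_decomposition M U d.
Proof.
move=> /symmetric_diagonalizable [U [d [UU ->]]].
pose t := [tuple d 0 i | i < n].
have /tuple_permP [p tp] : perm_eq (sort >=%R t) t by rewrite perm_sort.
have srt := @sort_sorted _ >=%R (fun x y => le_total y x) t.
rewrite tp in srt.
pose U' := col_perm p U; pose d' : 'rV[R]_n := \row_i d 0 (p i).
have U'E : U' = U *m (perm_mx p)^T.
  by rewrite /U' col_permE tr_perm_mx.
exists U', d'; split.
- rewrite U'E trmx_mul trmxK mulmxA -[_ *m U^T *m U]mulmxA UU mulmx1.
  by rewrite tr_perm_mx -perm_mxM mulgV perm_mx1.
- move=> i j ij; rewrite !mxE.
  have := @sorted_leq_nth _ >=%R ge_trans (fun=> lexx _) 0 _ srt i j.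
  rewrite !inE size_tuple !ltn_ord => /(_ isT isT ij).
  by rewrite -!tnth_nth !tnth_mktuple.
- rewrite sum_col_dyad; apply/matrixP => a b.
  rewrite -[U *m _ *m _]mulmxA -[in RHS]mulmxA !mul_diag_mx !mxE.
  rewrite (reindex_inj (@perm_inj _ p)) /=; apply: eq_bigr => k _.
  by rewrite !mxE.
Qed.

Lemma char_poly_diag_conj U d :
  U^T *m U = 1%:M ->
  char_poly (U *m diag_mx d *m U^T) = \prod_(i < n) ('X - (d 0 i)%:P).
Proof.
move=> UU; have := char_poly_trig (diag_mx_is_trig d).
under eq_bigr do rewrite mxE eqxx mulr1n.
move=> <-; rewrite /char_poly /char_poly_mx.
pose V := map_mx (@polyC R) U.
have VV : V *m V^T = 1%:M.
  by rewrite /V map_trmx -map_mxM (mulmx1C UU) map_mx1.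
rewrite !map_mxM -/V -map_trmx -/V.
have {1}-> : 'X%:M = V *m 'X%:M *m V^T :> 'M[{poly R}]_n.
  by rewrite scalar_mxC -mulmxA VV mulmx1.
by rewrite -mulmxBl -mulmxBr !det_mulmx mulrAC -det_mulmx VV det1 mul1r.
Qed.

(** [spectrum] is a choice among lists, but the characteristic polynomial fixes the list up to
    permutation and sortedness fixes its order. *)
Lemma spectrum_eigen_decomposition M U d :
  eigen_decomposition M U d -> spectrum M = [seq d 0 i | i <- enum 'I_n].
Proof.
move=> dec; have ME := eigen_decomposition_mul dec.
have [UU dmon _] := dec.
have ok : is_spectrum M [seq d 0 i | i <- enum 'I_n].
  split; last by rewrite ME char_poly_diag_conj // big_map big_enum.
  rewrite sorted_pairwise; last exact: ge_trans.
  apply/(pairwiseP 0) => i j; rewrite !inE size_map size_enum_ord => i_n j_n ij.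
  have o : 'I_n by exact: Ordinal i_n.
  rewrite !(@nth_map _ o _ 0 (d 0) _ (enum _)) ?size_enum_ord //.
  by apply: dmon; rewrite !nth_enum_ord // ltnW.
rewrite /spectrum; case: xgetP => [s _ [srt char]|/(_ _ ok) //].
apply: (@sorted_eq _ >=%R ge_trans) => //.
- by move=> x y; rewrite andbC => /le_anti.
- by case: ok.
- by apply: prod_XsubC_eq; rewrite -char; case: ok.
Qed.

Lemma lambda_eigen_decomposition M U d (i : 'I_n) :
  eigen_decomposition M U d -> lambda M i.+1 = d 0 i.
Proof.
move=> /spectrum_eigen_decomposition dec; rewrite /lambda dec /=.
by rewrite (nth_map i) ?size_enum_ord // nth_ord_enum.
Qed.

Lemma pos_eig_sum_eigen_decomposition M U d :
  eigen_decomposition M U d -> pos_eig_sum M = \sum_i Num.max 0 (d 0 i).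
Proof.
move=> /spectrum_eigen_decomposition dec.
by rewrite /pos_eig_sum dec big_map big_enum.
Qed.

Lemma card_ord_ltn (k : nat) : (k <= n)%N -> #|[pred i : 'I_n | (i < k)%N]| = k.
Proof.
move=> kn; rewrite -sum1_card -(big_ord_widen n (fun=> 1%N) kn).
by rewrite sum1_card card_ord.
Qed.

Lemma min_eig_mult_card M U d (m : 'I_n) : m.+1 = n ->
  eigen_decomposition M U d -> min_eig_mult M = #|[pred i | d 0 i == d 0 m]|.
Proof.
move=> mn dec; have := lambda_eigen_decomposition m dec.
rewrite /min_eig_mult mn => ->.
have [UU _ _] := dec.
rewrite (eigen_decomposition_mul dec) char_poly_diag_conj //.
rewrite -(big_map (fun i => d 0 i) xpredT (fun x => 'X - x%:P)) mu_prod_XsubC.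
by rewrite count_map -sum1_card -sum1_count.
Qed.

(** Because [d] is nonincreasing, the indices of eigenvalues above the smallest one form an initial
    segment. Both directions compare cardinalities of initial segments. *)
Lemma min_eig_mult_ltn M U d (m : 'I_n) (i : 'I_n) : m.+1 = n ->
  eigen_decomposition M U d ->
  (i < n - min_eig_mult M)%N = (d 0 m < d 0 i).
Proof.
move=> mn dec; rewrite (min_eig_mult_card mn dec).
have [_ dmon _] := dec.
have dm j : d 0 m <= d 0 j by apply: dmon; rewrite -ltnS mn.
pose A := [pred j : 'I_n | d 0 m < d 0 j].
have -> : (n - #|[pred j : 'I_n | d 0%R j == d 0%R m]|)%N = #|A|.
  rewrite -[X in (X - _)%N]card_ord -(cardC A).
  rewrite (@eq_card _ [predC A] [pred j : 'I_n | d 0 j == d 0 m]) ?addnK // => j.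
  by rewrite !inE -leNgt eq_le dm andbT.
apply/idP/idP => [iA|di].
  rewrite ltNge; apply/negP => di; move: iA; apply/negP; rewrite -leqNgt.
  rewrite -[leqRHS](card_ord_ltn (ltnW (ltn_ord i))).
  apply: subset_leq_card; apply/fintype.subsetP => j; rewrite !inE => dj.
  rewrite ltnNge; apply/negP => /dmon ij.
  by have := lt_le_trans dj (le_trans ij di); rewrite ltxx.
rewrite -[leqLHS](card_ord_ltn (ltn_ord i)).
apply: subset_leq_card; apply/fintype.subsetP => j; rewrite !inE ltnS => ji.
exact: lt_le_trans di (dmon _ _ ji).
Qed.

End EigenDecomposition.

(** * Projections and the extragradient step in an inner product space *)

Section InnerProduct.
Variables (R : realFieldType) (W : lmodType R) (ip : W -> W -> R).
Hypothesis ipC : forall x y, ip x y = ip y x.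
Hypothesis ipDl : forall x y z, ip (x + y) z = ip x z + ip y z.
Hypothesis ipZl : forall a x y, ip (a *: x) y = a * ip x y.
Implicit Types (x y z P Q Y : W) (C : set W).

Lemma ipZr a x y : ip x (a *: y) = a * ip x y.
Proof. by rewrite ipC ipZl ipC. Qed.

Lemma ipDr x y z : ip x (y + z) = ip x y + ip x z.
Proof. by rewrite ipC ipDl !(ipC x). Qed.

Lemma ipNl x y : ip (- x) y = - ip x y.
Proof. by rewrite -scaleN1r ipZl mulN1r. Qed.

Lemma ipNr x y : ip x (- y) = - ip x y.
Proof. by rewrite ipC ipNl ipC. Qed.

Definition ip_linear := (ipDl, ipDr, ipNl, ipNr, ipZl, ipZr).

Lemma proj_variational C Y P :
  (forall Q t, C Q -> 0 <= t <= 1 -> C (P + t *: (Q - P))) ->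
  (forall Q, C Q -> ip (Y - P) (Y - P) <= ip (Y - Q) (Y - Q)) ->
  forall Q, C Q -> ip (Y - P) (Q - P) <= 0.
Proof.
move=> Ccvx Pmin Q CQ; set p := ip (Y - P) (Q - P).
set q := ip (Q - P) (Q - P).
have pq t : 0 < t <= 1 -> 2 * p <= t * q.
  move=> /andP[t0 t1]; have := Pmin _ (Ccvx Q t CQ _).
  rewrite ltW // t1 => /(_ isT).
  rewrite opprD addrA /p /q; move: (Y - P) (Q - P) => D E.
  rewrite !ip_linear (ipC E D).
  move=> h; suff : 0 <= t * (t * ip E E - 2 * ip D E).
    by rewrite pmulr_rge0 // subr_ge0.
  by move: h; lra.
rewrite leNgt; apply/negP => p0.
have q0 : 0 < q by have := pq 1; rewrite ltr01 lexx => /(_ isT); lra.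
(* For this [t] one has [t q <= p], whence [2 p <= p], against [p > 0]. *)
have := pq (Num.min 1 (p / q)).
rewrite lt_min ltr01 divr_gt0 // ge_min lexx => /(_ isT).
have : Num.min 1 (p / q) * q <= p by rewrite -ler_pdivlMr // ge_min lexx orbT.
lra.
Qed.

Lemma variational_pythagoras Y P Q : ip (Y - P) (Q - P) <= 0 ->
  ip (Y - P) (Y - P) + ip (Q - P) (Q - P) <= ip (Y - Q) (Y - Q).
Proof.
have -> : Y - Q = (Y - P) - (Q - P) by rewrite opprB addrA subrK.
move: (Y - P) (Q - P) => D E.
by rewrite !ip_linear (ipC E D); lra.
Qed.

(** Positivity is assumed only where the argument evaluates the form: [frob_dot] is nonnegative on
    symmetric matrices only, and the lemma also serves semidefinite forms. *)
Lemma ip_cauchy_schwarz x y :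
  (forall t, 0 <= ip (x + t *: y) (x + t *: y)) -> 0 <= ip y y ->
  ip x y ^+ 2 <= ip x x * ip y y.
Proof.
move=> pos y0.
have {}pos t : 0 <= ip x x + 2 * t * ip x y + t ^+ 2 * ip y y.
  by have := pos t; rewrite !ip_linear (ipC y x); lra.
have [yy|yy] := eqVneq (ip y y) 0.
  rewrite yy mulr0; have [-> |xy] := eqVneq (ip x y) 0; first by rewrite expr0n.
  (* The quadratic has degenerated to an affine function of [t]; at this point it equals [-1]. *)
  have := pos (- (ip x x + 1) / (2 * ip x y)).
  rewrite yy mulr0 addr0.
  have -> : 2 * (- (ip x x + 1) / (2 * ip x y)) * ip x y = - (ip x x + 1).
    by field.
  lra.
have y0' : 0 < ip y y by rewrite lt_def yy.
have := pos (- ip x y / ip y y).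
have -> : ip x x + 2 * (- ip x y / ip y y) * ip x y + (- ip x y / ip y y) ^+ 2 * ip y y
  = ip x x - ip x y ^+ 2 / ip y y by field.
by rewrite subr_ge0 ler_pdivrMr.
Qed.

(* The step from [z] to [z'] uses the operator value [Fu] at the
   extrapolated point [u], which is itself reached with the value [Fz] at [z]. *)
Lemma extragradient_descent C (eta : R) z u z' Fz Fu q :
  (forall P Q t, C P -> C Q -> 0 <= t <= 1 -> C (P + t *: (Q - P))) ->
  C u -> (forall Q, C Q ->
    ip (z - eta *: Fz - u) (z - eta *: Fz - u) <=
    ip (z - eta *: Fz - Q) (z - eta *: Fz - Q)) ->
  C z' -> (forall Q, C Q ->
    ip (z - eta *: Fu - z') (z - eta *: Fu - z') <=
    ip (z - eta *: Fu - Q) (z - eta *: Fu - Q)) ->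
  0 <= ip (eta *: (Fu - Fz) + (z' - u)) (eta *: (Fu - Fz) + (z' - u)) ->
  eta ^+ 2 * ip (Fz - Fu) (Fz - Fu) <= ip (z - u) (z - u) / 2 ->
  C q ->
  ip (z' - q) (z' - q) + ip (z - u) (z - u) / 2 + 2 * (eta * ip Fu (u - q))
  <= ip (z - q) (z - q).
Proof.
move=> Ccvx Cu umin Cz' zmin pos lip Cq.
(* [V1] tests the projection [u] against [z'], and [V2] tests [z'] against [q]. The remaining cross
   term [2 eta <Fu - Fz, z' - u>] is absorbed into [|z' - u|^2] by the square [pos], at the cost of
   [eta^2 |Fu - Fz|^2], which [lip] bounds by half of [|z - u|^2]. *)
have V1 := proj_variational (fun Q t => Ccvx u Q t Cu) umin Cz'.
have V2 := proj_variational (fun Q t => Ccvx z' Q t Cz') zmin Cq.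
move: V1 V2 pos lip.
rewrite !ip_linear.
rewrite ?(ipC u z) ?(ipC z' z) ?(ipC q z) ?(ipC Fz z) ?(ipC Fu z).
rewrite ?(ipC z' u) ?(ipC q u) ?(ipC Fz u) ?(ipC Fu u).
rewrite ?(ipC q z') ?(ipC Fz z') ?(ipC Fu z').
rewrite ?(ipC Fz q) ?(ipC Fu q) ?(ipC Fu Fz).
lra.
Qed.

End InnerProduct.

(** * The Frobenius inner product and projections onto the spectrahedron *)

Lemma continuous_big_sum (R : realType) (T : topologicalType) (I : Type)
    (s : seq I) (P : pred I) (F : I -> T -> R) :
  (forall i, continuous (F i)) -> continuous (fun x => \sum_(i <- s | P i) F i x).
Proof.
move=> cF; elim: s => [|i s IHs].
  rewrite (_ : (fun x => _) = cst 0); first exact: cst_continuous.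
  by apply/funext => x; rewrite big_nil.
have [Pi|nPi] := boolP (P i); last first.
  rewrite (_ : (fun x => _) = fun x => \sum_(j <- s | P j) F j x) //.
  by apply/funext => x; rewrite big_cons (negbTE nPi).
rewrite (_ : (fun x => _) = F i \+ (fun x => \sum_(j <- s | P j) F j x)).
  by move=> x; apply: cvgD; [exact: cF|exact: IHs].
by apply/funext => x; rewrite big_cons Pi.
Qed.

Section Frobenius.
Variables (R : realType) (n : nat).
Implicit Types (A B C M P Q U : 'M[R]_n) (d p : 'rV[R]_n).

Lemma frob_dotC A B : frob_dot A B = frob_dot B A.
Proof. exact: mxtrace_mulC. Qed.

Lemma frob_dotDl A B C : frob_dot (A + B) C = frob_dot A C + frob_dot B C.
Proof. by rewrite /frob_dot mulmxDl mxtraceD. Qed.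

Lemma frob_dotZl (a : R) A B : frob_dot (a *: A) B = a * frob_dot A B.
Proof. by rewrite /frob_dot -scalemxAl mxtraceZ. Qed.

Lemma frob_dotBl A B C : frob_dot (A - B) C = frob_dot A C - frob_dot B C.
Proof. by rewrite frob_dotDl -scaleN1r frob_dotZl mulN1r. Qed.

Lemma frob_dotBr A B C : frob_dot A (B - C) = frob_dot A B - frob_dot A C.
Proof. by rewrite frob_dotC frob_dotBl !(frob_dotC A). Qed.

(** Symmetry turns the trace of [A *m A] into a sum of squares; on general matrices this form is
    indefinite, hence the symmetry side conditions throughout. *)
Lemma frob_dot_symE A : A^T = A -> frob_dot A A = \sum_i \sum_j A i j ^+ 2.
Proof.
move=> symA; rewrite /frob_dot /mxtrace; apply: eq_bigr => i _.
by rewrite mxE; apply: eq_bigr => j _; rewrite -{2}symA mxE expr2.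
Qed.

Lemma frob_dot_ge0 A : A^T = A -> 0 <= frob_dot A A.
Proof.
move=> /frob_dot_symE ->.
by apply: sumr_ge0 => i _; apply: sumr_ge0 => j _; rewrite sqr_ge0.
Qed.

Lemma frob_dot_eq0 A : A^T = A -> frob_dot A A = 0 -> A = 0.
Proof.
move=> /frob_dot_symE -> /eqP; rewrite psumr_eq0 => [/allP h|i _]; last first.
  by apply: sumr_ge0 => j _; rewrite sqr_ge0.
apply/matrixP => i j; rewrite mxE.
have := h i (mem_index_enum _); rewrite /= psumr_eq0 => [/allP|k _]; last first.
  by rewrite sqr_ge0.
by move=> /(_ j (mem_index_enum _)); rewrite sqrf_eq0 => /eqP.
Qed.

Lemma sqr_frob_norm A : A^T = A -> frob_norm A ^+ 2 = frob_dot A A.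
Proof. by move=> symA; rewrite sqr_sqrtr // frob_dot_ge0. Qed.

Lemma symB A B : A^T = A -> B^T = B -> (A - B)^T = A - B.
Proof. by move=> symA symB; rewrite linearB /= symA symB. Qed.

Lemma symD A B : A^T = A -> B^T = B -> (A + B)^T = A + B.
Proof. by move=> symA symB; rewrite linearD /= symA symB. Qed.

Lemma symZ (a : R) A : A^T = A -> (a *: A)^T = a *: A.
Proof. by move=> symA; rewrite linearZ /= symA. Qed.

Lemma frob_norm_ge0 A : 0 <= frob_norm A.
Proof. exact: sqrtr_ge0. Qed.

Lemma ler_frob_norm A B : A^T = A -> B^T = B ->
  (frob_norm A <= frob_norm B) = (frob_dot A A <= frob_dot B B).
Proof. by move=> sA sB; rewrite ler_sqrt // frob_dot_ge0. Qed.

Lemma frob_cauchy_schwarz A B : A^T = A -> B^T = B ->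
  `|frob_dot A B| <= frob_norm A * frob_norm B.
Proof.
move=> sA sB; rewrite -ler_sqr ?nnegrE ?mulr_ge0 ?frob_norm_ge0 //.
rewrite exprMn !sqr_frob_norm // real_normK ?num_real //.
apply: (ip_cauchy_schwarz frob_dotC frob_dotDl frob_dotZl) => [t|].
  exact/frob_dot_ge0/symD/symZ.
exact: frob_dot_ge0.
Qed.

Lemma frob_normD A B : A^T = A -> B^T = B ->
  frob_norm (A + B) <= frob_norm A + frob_norm B.
Proof.
move=> sA sB; rewrite -ler_sqr ?nnegrE ?addr_ge0 ?frob_norm_ge0 //.
rewrite sqrrD !sqr_frob_norm //; last exact: symD.
rewrite frob_dotDl !(frob_dotC _ (A + B)) !frob_dotDl (frob_dotC B A).
have := frob_cauchy_schwarz sA sB; have := ler_norm (frob_dot A B).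
lra.
Qed.

Lemma frob_normZ (a : R) A : 0 <= a -> frob_norm (a *: A) = a * frob_norm A.
Proof.
move=> a0; rewrite /frob_norm frob_dotZl frob_dotC frob_dotZl mulrA -expr2.
by rewrite sqrtrM ?sqr_ge0 // sqrtr_sqr ger0_norm.
Qed.

Lemma frob_normN A : frob_norm (- A) = frob_norm A.
Proof. by rewrite /frob_norm /frob_dot mulmxN mulNmx opprK. Qed.

End Frobenius.

(** * Projections onto the spectrahedron and their truncations *)

Section Spectrahedron.
Variables (R : realType) (n : nat).
Implicit Types (A B M P Q U : 'M[R]_n) (d p : 'rV[R]_n) (C : set 'M[R]_n).
Local Notation S := (spectrahedron R n).

Lemma spectrahedron_convex P Q t :
  S P -> S Q -> 0 <= t <= 1 -> S (P + t *: (Q - P)).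
Proof.
move=> [sP pP tP] [sQ pQ tQ] /andP[t0 t1]; split.
- exact/symD/symZ/symB.
- move=> v; rewrite mulmxDr mulmxDl -scalemxAr -scalemxAl mulmxBr mulmxBl.
  have := pP v; have := pQ v; rewrite !mxE; nra.
- by rewrite mxtraceD mxtraceZ raddfB /= tP tQ subrr mulr0 addr0.
Qed.

Lemma conj_trace U Q : U^T *m U = 1%:M ->
  \sum_i (U^T *m Q *m U) i i = \tr Q.
Proof.
by move=> UU; rewrite -/(mxtrace _) mxtrace_mulC mulmxA (mulmx1C UU) mul1mx.
Qed.

Lemma spectrahedron_diag_conj U p : U^T *m U = 1%:M ->
  (forall i, 0 <= p 0 i) -> \sum_i p 0 i = 1 -> S (U *m diag_mx p *m U^T).
Proof.
move=> UU p0 p1; split; first exact: diag_conj_sym.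
  move=> v; rewrite -!mulmxA mulmxA -[X in v^T *m X]trmxK -trmx_mul.
  move: (U^T *m v) => x; rewrite mul_diag_mx mxE; apply: sumr_ge0 => i _.
  by rewrite !mxE mulrCA mulr_ge0 // -expr2 sqr_ge0.
by rewrite mxtrace_mulC mulmxA UU mul1mx mxtrace_diag.
Qed.

Lemma diag_conjB U d p :
  U *m diag_mx d *m U^T - U *m diag_mx p *m U^T = U *m diag_mx (d - p) *m U^T.
Proof. by rewrite [diag_mx (d - p)]linearB /= mulmxBr mulmxBl. Qed.

(* The hypotheses say that [d - p - c] is nonpositive on the coordinates that
   [C] can charge and vanishes where [p] does not. *)
Lemma spectral_proj_pythagoras C U d p (c : R) :
  U^T *m U = 1%:M -> C `<=` S -> C (U *m diag_mx p *m U^T) ->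
  (forall Q i, C Q -> (d 0 i - p 0 i - c) * (U^T *m Q *m U) i i <= 0) ->
  (forall i, (d 0 i - p 0 i - c) * p 0 i = 0) ->
  let M := U *m diag_mx d *m U^T in
  let P := U *m diag_mx p *m U^T in
  forall Q, C Q ->
  frob_dot (M - P) (M - P) + frob_dot (Q - P) (Q - P) <= frob_dot (M - Q) (M - Q).
Proof.
move=> UU CS CP le0 eq0 M P Q CQ.
apply: (variational_pythagoras (@frob_dotC _ _) (@frob_dotDl _ _) (@frob_dotZl _ _)).
(* All competitors have trace 1, so shifting the spectrum of [M - P] by [c] changes every pairing by
   the same constant and leaves only the signs given by [le0] and [eq0]. *)
have HE T : \tr T = 1 -> frob_dot (M - P) T =
    \sum_i (d 0 i - p 0 i - c) * (U^T *m T *m U) i i + c.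
  move=> trT; rewrite /M /P diag_conjB /frob_dot mxtrace_diag_conj.
  rewrite -[X in _ = _ + X]mulr1 -{1}trT -(conj_trace T UU) mulr_sumr -big_split.
  by apply: eq_bigr => i _; rewrite !mxE /=; ring.
have [_ _ trP] := CS _ CP; have [_ _ trQ] := CS _ CQ.
rewrite frob_dotBr !HE // opprD addrACA subrr addr0 [X in _ - X]big1 => [|i _].
  by rewrite subr0; apply: sumr_le0 => i _; exact: le0.
rewrite /P !mulmxA UU mul1mx -mulmxA UU mulmx1 mxE eqxx.
exact: eq0.
Qed.

(** The extra term [|Q - P|^2] in the Pythagorean inequality gives uniqueness besides minimality, so
    any projection can be identified with an explicit candidate. *)
Lemma is_frob_proj_pythagoras C M P : M^T = M -> (forall Q, C Q -> Q^T = Q) ->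
  C P ->
  (forall Q, C Q -> frob_dot (M - P) (M - P) + frob_dot (Q - P) (Q - P)
     <= frob_dot (M - Q) (M - Q)) ->
  is_frob_proj C M P /\ forall P', is_frob_proj C M P' -> P' = P.
Proof.
move=> sM sC CP pyth; split.
  split=> // Q CQ; rewrite ler_frob_norm; try by apply: symB => //; exact: sC.
  apply: le_trans (pyth _ CQ); rewrite lerDl frob_dot_ge0 //.
  by apply: symB; exact: sC.
move=> P' [CP' minP']; have := minP' _ CP.
rewrite ler_frob_norm; try by apply: symB => //; exact: sC.
have := pyth _ CP' => h1 h2.
apply/eqP; rewrite -subr_eq0; apply/eqP/frob_dot_eq0.
  by apply: symB; exact: sC.
apply: le_anti; rewrite frob_dot_ge0 ?andbT; first lra.
by apply: symB; exact: sC.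
Qed.

(** Intermediate value theorem for the total mass above level [c]: it is at least 1 at [d_r] and 0
    at [b], which exceeds every retained eigenvalue since each gap is at most the sum of the
    gaps. *)
Lemma water_level d (r : 'I_n) (P : pred 'I_n) :
  (forall i, P i -> d 0 r <= d 0 i) ->
  1 <= \sum_(i | P i) (d 0 i - d 0 r) ->
  exists2 c, d 0 r <= c & \sum_(i | P i) Num.max 0 (d 0 i - c) = 1.
Proof.
move=> rP s1; pose phi c : R := \sum_(i | P i) Num.max 0 (d 0 i - c).
pose b := d 0 r + \sum_(i | P i) (d 0 i - d 0 r).
have dle j : P j -> d 0 j <= b.
  move=> Pj; rewrite /b (bigD1 j) //= addrA [d 0 r + _]addrC subrK lerDl.
  by apply: sumr_ge0 => i /andP[Pi _]; rewrite subr_ge0 rP.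
have rb : d 0 r <= b by rewrite /b lerDl (le_trans ler01).
have cphi : continuous phi.
  apply: continuous_big_sum => i c.
  apply: (@continuous_max R R (cst 0) (fun c => d 0 i - c) c).
    exact: cvg_cst.
  by apply: cvgB; [exact: cvg_cst|exact: cvg_id].
have [||c] := @IVT R phi (d 0 r) b 1 rb.
- exact: continuous_subspaceT.
- have -> : phi b = 0.
    rewrite /phi big1 // => i Pi; apply/max_idPl.
    by rewrite subr_le0 dle.
  have phir : 1 <= phi (d 0 r).
    apply: le_trans s1 _; apply: ler_sum => i Pi; by rewrite le_max lexx orbT.
  by rewrite ge_min ler01 orbT le_max phir.
- by rewrite in_itv /= => /andP[cr _] phic; exists c.
Qed.

(* The projection is [sum_i max(0, d_i - c) u_i u_i^T]; the gap makes the water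
   level [c] at least [d_r], so it has no mass on the discarded eigenvectors. *)
Lemma truncated_proj_gap (r : 'I_n) M P : is_frob_proj S M P ->
  (forall U d, eigen_decomposition M U d ->
     1 <= \sum_(i < n | (i < r)%N) (d 0 i - d 0 r)) ->
  truncated_proj r M P /\ (1 <= pos_eig_sum M -> zero_truncated_proj r M P).
Proof.
move=> projP gap.
suff main U d : eigen_decomposition M U d ->
    is_frob_proj (spectrahedron_face r U) (truncation r U d) P /\
    (1 <= pos_eig_sum M -> is_frob_proj S (truncation r U d) P).
  split=> [U d /main[]//|pos U d /main[_]]; exact.
move=> dec; have [UU dmon _] := dec.
have ME := eigen_decomposition_mul dec.
have [c rc csum] := water_level (fun i (ir : (i < r)%N) => dmon _ _ (ltnW ir))
  (gap _ _ dec).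
pose p : 'rV[R]_n := \row_i Num.max 0 (d 0 i - c).
have p0 i : 0 <= p 0 i by rewrite mxE le_max lexx.
have pr (i : 'I_n) : (r <= i)%N -> p 0 i = 0.
  by move=> ri; rewrite mxE; apply/max_idPl; have := dmon _ _ ri; lra.
have psum : \sum_i p 0 i = 1.
  rewrite (bigID (fun i : 'I_n => (i < r)%N)) /= [X in _ + X]big1 => [|i].
    by rewrite addr0 -[RHS]csum; apply: eq_bigr => i _; rewrite mxE.
  by rewrite -leqNgt; exact: pr.
pose P' := U *m diag_mx p *m U^T.
have SP' : S P' by exact: spectrahedron_diag_conj.
have conj_ge0 Q i : S Q -> 0 <= (U^T *m Q *m U) i i.
  by case=> _ posQ _; rewrite conj_entry_col.
(* Optimality conditions of the projection: [c] is the multiplier of the trace constraint, and the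
   slack vanishes where [p] is positive. *)
have kkt i : d 0 i - p 0 i - c <= 0 /\ (d 0 i - p 0 i - c) * p 0 i = 0.
  rewrite mxE; have [h|h] := leP 0 (d 0 i - c); rewrite ?mulr0; split=> //; lra.
have PE : P = P'.
  have [||||_] := @is_frob_proj_pythagoras S M P' => //.
  - by rewrite ME diag_conj_sym.
  - by move=> Q [].
  - rewrite ME; apply: (@spectral_proj_pythagoras S U d p c) => //.
    + move=> Q i SQ; rewrite mulr_le0_ge0 ?conj_ge0 //; by case: (kkt i).
    + by move=> i; case: (kkt i).
  - exact.
rewrite PE truncationE; set d' := \row_i _.
split=> [|pos].
  have faceP' : spectrahedron_face r U P'.
    split=> // i ri; rewrite /P' -mulmxA.
    have -> : U^T *m col i U = delta_mx i 0 by rewrite colE mulmxA UU mul1mx.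
    rewrite -mulmxA mul_diag_mx; apply/matrixP => a b; rewrite !mxE.
    rewrite big1 // => k _; rewrite !mxE.
    have [->|ki] := eqVneq k i; last by rewrite !mulr0.
    by have := pr _ ri; rewrite mxE => ->; rewrite mul0r mulr0.
  have [||||] := @is_frob_proj_pythagoras (spectrahedron_face r U)
    (U *m diag_mx d' *m U^T) P'.
  - exact: diag_conj_sym.
  - by move=> Q [[]].
  - exact: faceP'.
  - apply: (@spectral_proj_pythagoras _ U d' p c) => //.
    + by move=> Q [].
    + move=> Q i [SQ Q0]; have [ir|ri] := ltnP i r.
        rewrite [d' 0 i]mxE ir mulr_le0_ge0 ?conj_ge0 //; by case: (kkt i).
      by rewrite conj_entry_col -mulmxA Q0 // mulmx0 [X in _ * X]mxE mulr0.
    + move=> i; have [ir|ri] := ltnP i r; last by rewrite pr // mulr0.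
      by rewrite [d' 0 i]mxE ir; case: (kkt i).
  - by case.
(* A discarded eigenvalue is now 0, so its slack is [-c] and must be nonpositive. If [c < 0], then
   [p] dominates the positive parts of the eigenvalues, which already sum to at least 1, so the two
   coincide; with [c < 0] this forces [p = 0], against its sum 1. *)
have c0 : 0 <= c.
  rewrite leNgt; apply/negP => cneg; move: pos; apply/negP.
  rewrite (pos_eig_sum_eigen_decomposition dec) -ltNge -psum.
  have le i : true -> Num.max 0 (d 0 i) <= p 0 i.
    by rewrite mxE; have [h|h] := leP 0 (d 0 i - c); have [h'|h'] := leP 0 (d 0 i); lra.
  rewrite lt_def (ler_sum _ le) andbT; apply/eqP => peq.
  have dp i : p 0 i = 0.
    have : \sum_i (p 0 i - Num.max 0 (d 0 i)) = 0 by rewrite sumrB peq subrr.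
    move/eqP; rewrite psumr_eq0 => [/allP/(_ i (mem_index_enum _))|j _].
      rewrite mxE /= => /eqP.
      by have [h|h] := leP 0 (d 0 i - c); have [h'|h'] := leP 0 (d 0 i); lra.
    by rewrite subr_ge0 le.
  by have := psum; rewrite big1 // => /eqP; rewrite eq_sym oner_eq0.
have [||||] := @is_frob_proj_pythagoras S (U *m diag_mx d' *m U^T) P'.
- exact: diag_conj_sym.
- by move=> Q [].
- exact: SP'.
- apply: (@spectral_proj_pythagoras _ U d' p c) => //.
  + move=> Q i SQ; rewrite mulr_le0_ge0 ?conj_ge0 //.
    have [ir|ri] := ltnP i r; rewrite [d' 0 i]mxE.
      by rewrite ir; case: (kkt i).
    by rewrite pr // ltnNge ri /=; lra.
  + move=> i; have [ir|ri] := ltnP i r; last by rewrite pr // mulr0.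
    by rewrite [d' 0 i]mxE ir; case: (kkt i).
- by case.
Qed.

End Spectrahedron.

(** * The rank gap around the saddle point *)

(** Cauchy-Schwarz for the semidefinite form of [Q], applied to [Q v] and [v], gives
    [|Q v|^2 = 0]. *)
Lemma psd_kernel (R : realType) (n : nat) (Q : 'M[R]_n) (v : 'cV[R]_n) :
  Q^T = Q -> (forall x : 'cV[R]_n, 0 <= (x^T *m Q *m x) 0 0) ->
  (v^T *m Q *m v) 0 0 = 0 -> Q *m v = 0.
Proof.
move=> symQ posQ vQv; pose ip (x y : 'cV[R]_n) := (x^T *m Q *m y) 0 0.
have ipC x y : ip x y = ip y x.
  have xQy : (y^T *m Q *m x)^T = x^T *m Q *m y.
    by rewrite !trmx_mul trmxK symQ mulmxA.
  by rewrite /ip -xQy mxE.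
have ipDl x y z : ip (x + y) z = ip x z + ip y z.
  by rewrite /ip linearD !mulmxDl mxE.
have ipZl a x y : ip (a *: x) y = a * ip x y.
  by rewrite /ip linearZ -!scalemxAl mxE.
have := @ip_cauchy_schwarz R 'cV[R]_n ip ipC ipDl ipZl (Q *m v) v.
move=> /(_ (fun t => posQ _) (posQ _)).
rewrite [ip v v]vQv mulr0 => /(conj (sqr_ge0 _)) /andP /le_anti /esym /eqP.
rewrite sqrf_eq0 /ip -mulmxA mxE psumr_eq0 => [/allP h|i _]; last first.
  by rewrite mxE -expr2 sqr_ge0.
apply/colP => i; have := h i (mem_index_enum _).
by rewrite mxE -expr2 sqrf_eq0 => /eqP ->; rewrite mxE.
Qed.

Lemma projector_conj_ge0 (R : realType) (n : nat) (Q U : 'M[R]_n) i :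
  Q^T = Q -> Q *m Q = Q -> 0 <= (U^T *m Q *m U) i i.
Proof.
move=> symQ QQ; rewrite -{1}QQ -{1}symQ mulmxA -trmx_mul -mulmxA mxE.
by apply: sumr_ge0 => k _; rewrite mxE -expr2 sqr_ge0.
Qed.

(** The range of [Q] lies in the span of the columns of index at most [j], on which the quadratic
    form is at least [d_j]. *)
Lemma mul_projector_trace (R : realType) (n : nat) (U Q : 'M[R]_n) (d : 'rV[R]_n)
    (j : 'I_n) :
  U^T *m U = 1%:M -> (forall i k : 'I_n, (i <= k)%N -> d 0 k <= d 0 i) ->
  Q^T = Q -> Q *m Q = Q -> (forall i : 'I_n, (j < i)%N -> Q *m col i U = 0) ->
  d 0 j * \tr Q <= frob_dot (U *m diag_mx d *m U^T) Q.
Proof.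
move=> UU dmon symQ QQ Q0; rewrite /frob_dot mxtrace_diag_conj.
rewrite -(conj_trace Q UU) mulr_sumr; apply: ler_sum => i _.
have [ij|ji] := leqP i j.
  by apply: ler_wpM2r; [exact: projector_conj_ge0|exact: dmon].
rewrite conj_entry_col -mulmxA Q0 // mulmx0.
by rewrite [X in _ * X]mxE [X in _ <= _ * X]mxE !mulr0.
Qed.

(** The projector is [B^T (B B^T)^-1 B]; the Gram matrix is invertible because [x B B^T = 0] forces
    [|x B|^2 = 0]. The factor [Y] records that the rows of [Q] are combinations of those of [B]. *)
Lemma row_free_projector (R : realType) (k n : nat) (B : 'M[R]_(k, n)) :
  row_free B -> exists Q : 'M[R]_n,
    [/\ Q^T = Q, Q *m Q = Q, \tr Q = k%:R & (exists Y : 'M[R]_(n, k), Q = Y *m B)].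
Proof.
move=> freeB.
have gram : B *m B^T \in unitmx.
  rewrite -row_free_unit -kermx_eq0; apply/eqP/row_matrixP => i.
  rewrite row0; have : row i (kermx (B *m B^T)) *m (B *m B^T) = 0.
    by rewrite -row_mul mulmx_ker row0.
  move: (row i _) => x xBB; have xB : x *m B = 0.
    have : (x *m B *m (x *m B)^T) 0 0 = 0.
      by rewrite trmx_mul mulmxA -[x *m B *m _]mulmxA xBB mul0mx mxE.
    rewrite mxE => /eqP; rewrite psumr_eq0 => [/allP h|j _]; last first.
      by rewrite [X in _ * X]mxE -expr2 sqr_ge0.
    apply/rowP => j; have := h j (mem_index_enum _).
    by rewrite /= [X in _ * X]mxE -expr2 sqrf_eq0 => /eqP ->; rewrite mxE.
  by apply: (row_free_inj freeB); rewrite xB mul0mx.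
have symI : (invmx (B *m B^T))^T = invmx (B *m B^T).
  by rewrite trmx_inv trmx_mul trmxK.
exists (B^T *m invmx (B *m B^T) *m B); split.
- by rewrite !trmx_mul trmxK symI mulmxA.
- by rewrite -!mulmxA [B *m (B^T *m _)]mulmxA mulKmx.
- by rewrite mxtrace_mulC mulmxA mulmxV // mxtrace1.
- by exists (B^T *m invmx (B *m B^T)).
Qed.

(* The row spaces orthogonal to [u_i] ([i > r]) and to [w_i] ([i > j]) have
   dimensions [r + 1] and [j + 1], so they meet in dimension at least [k]. *)
Lemma cap_projector (R : realType) (n k : nat) (U W : 'M[R]_n) (r j : 'I_n) :
  (n + k <= j + r + 2)%N -> exists Q : 'M[R]_n,
  [/\ Q^T = Q, Q *m Q = Q, exists2 l, (k <= l)%N & \tr Q = l%:R,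
      forall i : 'I_n, (r < i)%N -> Q *m col i U = 0
    & forall i : 'I_n, (j < i)%N -> Q *m col i W = 0].
Proof.
move=> dim.
(* [f l] enumerates the indices strictly above [l]. Below, [K] thus has [(n - r - 1) + (n - j - 1)]
   columns, and its left kernel has dimension at least [j + r + 2 - n]. *)
pose f (l : 'I_n) (a : 'I_(n - l.+1)) : 'I_n :=
  cast_ord (subnKC (ltn_ord l)) (rshift l.+1 a).
have fP (l i : 'I_n) : (l < i)%N -> exists a, f l a = i.
  move=> li; have ia : (i - l.+1 < n - l.+1)%N by rewrite ltn_sub2r // (leq_ltn_trans li).
  by exists (Ordinal ia); apply: val_inj => /=; rewrite subnKC.
pose K := row_mx (colsub (f r) U) (colsub (f j) W).
have [Q [symQ QQ trQ [Y QY]]] := row_free_projector (row_base_free (kermx K)).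
have QK : Q *m K = 0.
  rewrite QY -mulmxA (_ : row_base _ *m K = 0) ?mulmx0 //.
  by apply/sub_kermxP; rewrite eq_row_base.
exists Q; split=> //.
- exists (\rank (kermx K)) => //; rewrite mxrank_ker.
  have := rank_leq_col K; have := ltn_ord r; have := ltn_ord j; lia.
- move=> i /fP[a fa]; apply/colP => b.
  have := congr1 (fun N => fun_of_matrix N b (lshift _ a)) QK.
  rewrite /= [X in X = _ -> _]mxE [X in _ = X -> _]mxE => QKb.
  rewrite [LHS]mxE [RHS]mxE -[RHS]QKb; apply: eq_bigr => c _.
  by rewrite row_mxEl !mxE fa.
- move=> i /fP[a fa]; apply/colP => b.
  have := congr1 (fun N => fun_of_matrix N b (rshift _ a)) QK.
  rewrite /= [X in X = _ -> _]mxE [X in _ = X -> _]mxE => QKb.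
  rewrite [LHS]mxE [RHS]mxE -[RHS]QKb; apply: eq_bigr => c _.
  by rewrite row_mxEr !mxE fa.
Qed.

Lemma projector_frob_norm (R : realType) (n : nat) (Q : 'M[R]_n) :
  Q *m Q = Q -> frob_norm Q = Num.sqrt (\tr Q).
Proof. by move=> QQ; rewrite /frob_norm /frob_dot QQ. Qed.

Section Gap.
Variables (R : realType) (n : nat) (W : 'M[R]_n) (g : 'rV[R]_n) (m : 'I_n).
Variables (G Xs : 'M[R]_n).
Hypothesis decG : eigen_decomposition G W g.
Hypothesis mn : m.+1 = n.
Hypothesis SXs : spectrahedron R n Xs.
Hypothesis optXs : forall B, spectrahedron R n B -> 0 <= frob_dot G (B - Xs).
Local Notation rt := (min_eig_mult G).

Lemma min_eig_mult_bounds : (0 < rt <= n)%N.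
Proof.
have [WW gmon _] := decG; apply/andP; split.
  have := min_eig_mult_ltn m mn decG; rewrite ltxx => /negbT.
  by rewrite -leqNgt; have := ltn_ord m; lia.
by rewrite (min_eig_mult_card mn decG) -[leqRHS]card_ord max_card.
Qed.

(** Complementary slackness: comparing [Xs] with the rank-one matrix on the last eigenvector shows
    that a sum of nonnegative terms [(g_l - g_m) x_l] is at most 0, so [Xs] has no mass above the
    smallest eigenvalue. *)
Lemma optimal_kernel (i : 'I_n) : (i < n - rt)%N -> Xs *m col i W = 0.
Proof.
rewrite (min_eig_mult_ltn _ mn decG) => gmi.
have [WW gmon _] := decG; have [symX posX trX] := SXs.
have GE := eigen_decomposition_mul decG.
pose e : 'rV[R]_n := \row_l (l == m)%:R.
have esum : \sum_l e 0 l = 1.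
  rewrite (bigD1 m) //= big1 => [|l lm]; first by rewrite mxE eqxx addr0.
  by rewrite mxE (negbTE lm).
have SB : spectrahedron R n (W *m diag_mx e *m W^T).
  by apply: spectrahedron_diag_conj => // l; rewrite mxE ler0n.
have x0 l : 0 <= (W^T *m Xs *m W) l l by rewrite conj_entry_col.
have gm l : 0 <= g 0 l - g 0 m.
  by rewrite subr_ge0; apply: gmon; rewrite -ltnS mn.
have : \sum_l (g 0 l - g 0 m) * (W^T *m Xs *m W) l l <= 0.
  under eq_bigr do rewrite mulrBl.
  rewrite sumrB -mulr_sumr (conj_trace _ WW) trX mulr1 -mxtrace_diag_conj -GE.
  have GB : frob_dot G (W *m diag_mx e *m W^T) = g 0 m.
    rewrite GE /frob_dot mxtrace_diag_conj (bigD1 m) //= big1 => [|l lm].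
      by rewrite !mulmxA WW mul1mx -mulmxA WW mulmx1 !mxE !eqxx addr0 mulr1.
    by rewrite !mulmxA WW mul1mx -mulmxA WW mulmx1 !mxE eqxx (negbTE lm) mulr0.
  by have := optXs SB; rewrite frob_dotBr GB; lra.
rewrite le_eqVlt ltNge sumr_ge0 ?orbF => [|l _]; last exact: mulr_ge0.
rewrite psumr_eq0 => [/allP/(_ i (mem_index_enum _))|l _]; last exact: mulr_ge0.
rewrite mulf_eq0 gt_eqF ?subr_gt0 //= => /eqP xi.
by apply: psd_kernel => //; rewrite -conj_entry_col.
Qed.

Lemma optimal_mul_projector (j : 'I_n) (Q : 'M[R]_n) : Q^T = Q ->
  (j < n - rt)%N -> (forall i : 'I_n, (j < i)%N -> Q *m col i W = 0) ->
  Xs *m Q = 0.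
Proof.
move=> symQ jrt Q0; have [WW _ _] := decG.
suff XWWQ : (Xs *m W) *m (W^T *m Q) = 0.
  by rewrite -XWWQ mulmxA -[Xs *m W *m _]mulmxA (mulmx1C WW) mulmx1.
apply/matrixP => a b; rewrite [RHS]mxE mxE big1 // => i _.
have [ij|ji] := leqP i j.
  have /(congr1 (fun N : 'cV_n => N a 0)) := optimal_kernel (leq_ltn_trans ij jrt).
  by rewrite colE mulmxA -colE !mxE => ->; rewrite mul0r.
have /(congr1 (fun N : 'cV_n => N b 0)) := Q0 _ ji.
rewrite colE mulmxA -colE -[W^T *m Q]trmxK trmx_mul trmxK symQ.
rewrite [X in X = _ -> _]mxE [X in _ = X -> _]mxE => QW.
by rewrite [X in _ * X]mxE QW mulr0.
Qed.

(** [P] projects onto the eigenspace of the smallest eigenvalue, which carries all of the unit trace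
    of [Xs] by [optimal_kernel]. *)
Lemma min_eigenspace_projector : exists P : 'M[R]_n,
  [/\ P^T = P, P *m P = P, \tr P = rt%:R, frob_dot Xs P = 1
    & frob_dot G P = rt%:R * g 0 m].
Proof.
have [WW gmon _] := decG; have [symX posX trX] := SXs.
have GE := eigen_decomposition_mul decG.
have gE (i : 'I_n) : ~~ (i < n - rt)%N = (g 0 i == g 0 m).
  have gm : g 0 m <= g 0 i by apply: gmon; rewrite -ltnS mn.
  by rewrite (min_eig_mult_ltn _ mn decG) -leNgt eq_le gm andbT.
pose e : 'rV[R]_n := \row_i (~~ (i < n - rt)%N)%:R.
have WPW i : (W^T *m (W *m diag_mx e *m W^T) *m W) i i = e 0 i.
  by rewrite !mulmxA WW mul1mx -mulmxA WW mulmx1 mxE eqxx.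
have trP : \sum_i e 0 i = rt%:R.
  rewrite (min_eig_mult_card mn decG) -sum1_card natr_sum [RHS]big_mkcond.
  by apply: eq_bigr => i _; rewrite mxE gE inE; case: ifP.
exists (W *m diag_mx e *m W^T); split.
- exact: diag_conj_sym.
- rewrite -!mulmxA (mulmxA W^T) WW mul1mx (mulmxA (diag_mx e)) mulmx_diag.
  congr (_ *m (diag_mx _ *m _)); apply/rowP => i; rewrite !mxE.
  by case: (~~ _); rewrite ?mulr0 ?mulr1.
- by rewrite -trP -(conj_trace _ WW); apply: eq_bigr => i _; rewrite WPW.
- rewrite frob_dotC /frob_dot mxtrace_diag_conj -trX -(conj_trace Xs WW).
  apply: eq_bigr => i _; rewrite mxE; case: ltnP => irt; last by rewrite mul1r.
  by rewrite conj_entry_col -mulmxA optimal_kernel // mulmx0 mxE mul0r.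
- rewrite {1}GE /frob_dot mxtrace_diag_conj -trP mulr_suml.
  apply: eq_bigr => i _; rewrite WPW mxE gE mulrC.
  by case: eqP => [->|]; rewrite ?mul0r.
Qed.

Variables (M U : 'M[R]_n) (d : 'rV[R]_n) (eta eps : R).
Hypothesis decM : eigen_decomposition M U d.
Hypothesis eta0 : 0 <= eta.
Hypothesis closeM : frob_norm (M - (Xs - eta *: G)) <= eps.

Let symM : M^T = M.
Proof. by rewrite (eigen_decomposition_mul decM) diag_conj_sym. Qed.

Let symG : G^T = G.
Proof. by rewrite (eigen_decomposition_mul decG) diag_conj_sym. Qed.

(** Cauchy-Schwarz, where a projector has Frobenius norm equal to the square root of its trace. *)
Let frob_dot_perturb (Q : 'M[R]_n) : Q^T = Q -> Q *m Q = Q ->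
  `|frob_dot M Q - (frob_dot Xs Q - eta * frob_dot G Q)| <= eps * Num.sqrt (\tr Q).
Proof.
move=> symQ QQ; rewrite -frob_dotZl -!frob_dotBl -(projector_frob_norm QQ).
have [symX _ _] := SXs.
apply: le_trans (frob_cauchy_schwarz _ symQ) _.
  by apply: symB => //; apply: symB => //; exact: symZ.
by apply: ler_wpM2r => //; exact: frob_norm_ge0.
Qed.

(* Test [M] against a projector of rank at least [k] onto a space on which
   [M >= d_r] and [G >= g_j], and which is orthogonal to the range of [Xs]. *)
Lemma discarded_eigenvalue_le (r j : 'I_n) (k : nat) :
  (0 < k)%N -> (n + k <= j + r + 2)%N -> (j < n - rt)%N ->
  d 0 r <= - eta * g 0 j + eps / Num.sqrt k%:R.
Proof.
move=> k0 dim jrt; have [UU dmon _] := decM; have [WW gmon _] := decG.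
have [Q [symQ QQ [l kl trQ] QU QW]] := cap_projector U W dim.
have dM := mul_projector_trace UU dmon symQ QQ QU.
have gG := mul_projector_trace WW gmon symQ QQ QW.
rewrite -(eigen_decomposition_mul decM) in dM.
rewrite -(eigen_decomposition_mul decG) in gG.
have := frob_dot_perturb symQ QQ.
have -> : frob_dot Xs Q = 0.
  by rewrite /frob_dot (optimal_mul_projector symQ jrt QW) mxtrace0.
rewrite trQ in dM gG *.
have l0 : 0 < l%:R :> R by rewrite ltr0n (leq_trans k0).
have sk0 : 0 < Num.sqrt k%:R :> R by rewrite sqrtr_gt0 ltr0n.
have skl : Num.sqrt k%:R <= Num.sqrt l%:R :> R.
  by apply: ler_wsqrtr; rewrite ler_nat.
have eps0 : 0 <= eps by apply: le_trans closeM; exact: frob_norm_ge0.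
(* The rank [l] may exceed [k]; after division by [l] the error is [eps / sqrt l], at most
   [eps / sqrt k]. *)
have : eps * Num.sqrt l%:R <= l%:R * (eps / Num.sqrt k%:R).
  rewrite -[X in X * (eps / _)](sqr_sqrtr (ltW l0)) expr2 -mulrA mulrC.
  rewrite ler_pM2l; last exact: lt_le_trans skl.
  by rewrite mulrA ler_pdivlMr // mulrC ler_wpM2r.
move: (eps / _) => x epsx /ler_normlP [_ h].
rewrite -(ler_pM2r l0); have := ler_wpM2l eta0 gG; lra.
Qed.

(** The sum is at least [<M, P> - rt d_r] for the eigenspace projector [P]. Here
    [<M, P> >= 1 - eta rt g_m - eps sqrt rt], and [d_r] is bounded by the preceding lemma; the
    hypothesis on [eps] is what is left. *)
Lemma rank_gap (r j : 'I_n) (k : nat) :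
  (0 < k)%N -> (n + k <= j + r + 2)%N -> (j < n - rt)%N ->
  eps * (Num.sqrt rt%:R + rt%:R / Num.sqrt k%:R) <=
    rt%:R * (eta * (g 0 j - g 0 m)) ->
  1 <= \sum_(i < n | (i < r)%N) (d 0 i - d 0 r).
Proof.
move=> k0 dim jrt eps_le; have dr := discarded_eigenvalue_le k0 dim jrt.
have [UU dmon _] := decM.
have [P [symP PP trP XP GP]] := min_eigenspace_projector.
have /ler_normlP [h _] := frob_dot_perturb symP PP.
rewrite XP GP trP in h.
(* The complementary projector [1 - P] also has nonnegative diagonal entries in the basis [U]. *)
have P1 i : (U^T *m P *m U) i i <= 1.
  have symC : (1%:M - P)^T = 1%:M - P by rewrite linearB /= trmx1 symP.
  have CC : (1%:M - P) *m (1%:M - P) = 1%:M - P.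
    by rewrite mulmxBl mulmxBr mulmxBr !mul1mx mulmx1 PP subrr subr0.
  have := projector_conj_ge0 U i symC CC.
  by rewrite mulmxBr mulmxBl mulmx1 UU !mxE eqxx subr_ge0.
have MP : frob_dot M P - d 0 r * rt%:R =
    \sum_i (d 0 i - d 0 r) * (U^T *m P *m U) i i.
  rewrite {1}(eigen_decomposition_mul decM) /frob_dot mxtrace_diag_conj.
  rewrite -trP -(conj_trace P UU) mulr_sumr -sumrB.
  by apply: eq_bigr => i _; rewrite mulrBl.
have {}MP : frob_dot M P - d 0 r * rt%:R <=
    \sum_(i < n | (i < r)%N) (d 0 i - d 0 r).
  rewrite MP [leRHS]big_mkcond; apply: ler_sum => i _.
  case: ltnP => ir.
    by rewrite ler_piMr // subr_ge0; apply: dmon; exact: ltnW.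
  by rewrite mulr_le0_ge0 ?projector_conj_ge0 // subr_le0; exact: dmon.
apply: le_trans MP.
have := ler_wpM2l (ler0n R rt) dr; move: eps_le h; rewrite -[_ / Num.sqrt k%:R]mulrC.
rewrite mulrA; lra.
Qed.

End Gap.

(** * Step size, convexity and gradients *)

Section StepSize.
Variable R : realType.

(** Inversion into [\bar R] reverses the order of nonnegative reals, including 0, which goes to
    [+oo]. *)
Lemma min_inve (a b : R) : 0 <= a -> 0 <= b ->
  Order.min (a%:E^-1)%E (b%:E^-1)%E = ((Num.max a b)%:E^-1)%E.
Proof.
wlog ab : a b / a <= b => [H a0 b0|a0 b0].
  have /orP[ab|ba] := le_total a b; first exact: H.
  by rewrite minC maxC; exact: H.
rewrite (max_idPr ab); apply/min_idPr; rewrite !inver.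
have [_|aN0] := eqVneq a 0; first by rewrite leey.
have a1 : 0 < a by rewrite lt_def aN0.
by rewrite gt_eqF ?lee_fin ?lef_pV2 ?posrE // (lt_le_trans a1).
Qed.

Lemma step_size_eq (a b c e : R) :
  0 <= a -> 0 <= b -> 0 <= c -> 0 <= e -> [|| a != 0, b != 0, c != 0 | e != 0] ->
  let mu := Num.max (Num.max (2 * Num.sqrt (a ^+ 2 + e ^+ 2))
                             (2 * Num.sqrt (b ^+ 2 + c ^+ 2)))
                    (Num.max (a + c) (b + e)) in
  0 < mu /\ step_size a b c e = mu^-1.
Proof.
move=> a0 b0 c0 e0 nz mu.
have s0 x y : 0 <= 2 * Num.sqrt (x ^+ 2 + y ^+ 2) :> R by rewrite mulr_ge0.
have mu0 : 0 < mu.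
  rewrite /mu !lt_max; apply/orP; right.
  case/or4P: nz => nz; apply/orP.
  - by left; rewrite ltr_wpDr // lt_def nz.
  - by right; rewrite ltr_wpDr // lt_def nz.
  - by left; rewrite ltr_wpDl // lt_def nz.
  - by right; rewrite ltr_wpDl // lt_def nz.
split=> //; rewrite /step_size !min_inve ?addr_ge0 // ?le_max ?s0 ?addr_ge0 //.
by rewrite -/mu inver gt_eqF.
Qed.

End StepSize.

(** * Convexity along segments and Jensen's inequality for averages *)

Section Convexity.
Variables (R : realType) (E : lmodType R).
Implicit Types (D : set E) (phi : E -> R).

Lemma convex_set_segment D x y t : convex_set (D : set (convex_lmodType E)) ->
  D x -> D y -> 0 <= t <= 1 -> D (x + t *: (y - x)).
Proof.
move=> cD Dx Dy /andP[t0 t1].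
have -> : x + t *: (y - x) = t *: y + (1 - t) *: x.
  by rewrite scalerBl scale1r scalerBr addrCA.
exact: (set_mem (cD y x (Itv01 t0 t1) (mem_set Dy) (mem_set Dx))).
Qed.

Lemma convex_function_segment D phi x y t :
  convex_function (D : set (convex_lmodType E)) phi ->
  D x -> D y -> 0 <= t <= 1 ->
  phi (x + t *: (y - x)) <= phi x + t * (phi y - phi x).
Proof.
move=> cphi Dx Dy /andP[t0 t1].
have -> : x + t *: (y - x) = t *: y + (1 - t) *: x.
  by rewrite scalerBl scale1r scalerBr addrCA.
have : phi (t *: y + (1 - t) *: x) <= t * phi y + (1 - t) * phi x.
  exact: (cphi (Itv01 t0 t1) y x (mem_set Dy) (mem_set Dx)).
lra.
Qed.

(** Induction on the running average, which moves by [(x_(T+1) - a) / (T+1)] at each step.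
    Membership is proved along with the inequality because the two-point inequality needs the
    previous average in [D]. *)
Lemma jensen_average D phi (x : nat -> E) (T : nat) :
  convex_set (D : set (convex_lmodType E)) ->
  convex_function (D : set (convex_lmodType E)) phi ->
  (forall t, (1 <= t)%N -> D (x t)) -> (1 <= T)%N ->
  D (T%:R^-1 *: \sum_(1 <= t < T.+1) x t) /\
  phi (T%:R^-1 *: \sum_(1 <= t < T.+1) x t) <=
    T%:R^-1 * \sum_(1 <= t < T.+1) phi (x t).
Proof.
move=> cD cphi Dx; case: T => // T _; elim: T => [|T [IHD IHphi]].
  by rewrite !big_nat1 invr1 scale1r mul1r; split=> //; exact: Dx.
set a := _ *: _ in IHD IHphi *; rewrite (big_nat_recr T.+2) // /=.
have T1 : T.+1%:R != 0 :> R by rewrite pnatr_eq0.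
have T2 : T.+2%:R != 0 :> R by rewrite pnatr_eq0.
have TE : T.+2%:R = T.+1%:R + 1 :> R by rewrite -natr1.
have t01 : 0 <= (T.+2%:R^-1 : R) <= 1.
  by rewrite invr_ge0 ler0n invf_le1 ?ltr0n // ler1n.
have -> : T.+2%:R^-1 *: (\sum_(1 <= i < T.+2) x i + x T.+2) =
    a + T.+2%:R^-1 *: (x T.+2 - a).
  have -> : \sum_(1 <= i < T.+2) x i = T.+1%:R *: a by rewrite scalerA divff ?scale1r.
  rewrite scalerBr scalerDr scalerA addrA [RHS]addrAC; congr (_ + _).
  rewrite -[X in _ = X - _]scale1r -scalerBl; congr (_ *: _).
  by rewrite TE in T2 *; field.
split; first by apply: convex_set_segment => //; exact: Dx.
apply: le_trans (convex_function_segment cphi IHD (Dx T.+2 isT) t01) _.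
rewrite (big_nat_recr T.+2) //=.
have {}IHphi : T.+1%:R * phi a <= \sum_(1 <= i < T.+2) phi (x i).
  by rewrite mulrC -ler_pdivlMr ?ltr0n // mulrC.
rewrite -(@ler_pM2l _ T.+2%:R) ?ltr0n // mulrA divff // mul1r.
rewrite mulrDr mulrA divff // mul1r; move: IHphi; rewrite TE; lra.
Qed.

End Convexity.

(** * Gradients along segments and local Lipschitz bounds *)

Section Gradient.
Variables (R : realType) (n : nat) (V : normedModType R).
Variables (dot : {dot V for idfun}).
Hypothesis dot_norm : forall u : V, `|u| = Num.sqrt (dot u u).
Implicit Types (f : 'M[R]_n -> V -> R) (A B H : 'M[R]_n) (u v h : V).

Lemma dotC u v : dot u v = dot v u.
Proof. by rewrite hermC expr0 mul1r. Qed.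

Lemma dotDl u v h : dot (u + v) h = dot u h + dot v h.
Proof. exact: linearDl. Qed.

Lemma dotZl a u v : dot (a *: u) v = a * dot u v.
Proof. exact: linearZl_LR. Qed.

Lemma dot_ge0 u : 0 <= dot u u.
Proof.
have [->|u0] := eqVneq u 0; last exact/ltW/neq0_dnorm_gt0.
by rewrite -(scale0r (0 : V)) dotZl mul0r.
Qed.

Lemma sqr_dot_norm u : `|u| ^+ 2 = dot u u.
Proof. by rewrite dot_norm sqr_sqrtr // dot_ge0. Qed.

Lemma dot_cauchy_schwarz u v : `|dot u v| <= `|u| * `|v|.
Proof.
rewrite -ler_sqr ?nnegrE ?mulr_ge0 // exprMn !sqr_dot_norm.
rewrite real_normK ?num_real //.
by apply: (ip_cauchy_schwarz dotC dotDl dotZl) => [t|]; exact: dot_ge0.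
Qed.

Lemma pair_norm_le H h : pair_norm H h <= frob_norm H + `|h|.
Proof.
have H0 := frob_norm_ge0 H; have h0 := normr_ge0 h.
rewrite -[leRHS]ger0_norm ?addr_ge0 // -sqrtr_sqr; apply: ler_wsqrtr.
by rewrite sqrrD -addrA lerD2l lerDr mulrn_wge0 // mulr_ge0.
Qed.

Lemma pair_normZ (t : R) H h : 0 <= t -> pair_norm (t *: H) (t *: h) = t * pair_norm H h.
Proof.
move=> t0; rewrite /pair_norm frob_normZ // normrZ (ger0_norm t0) !exprMn -mulrDr.
by rewrite sqrtrM ?sqr_ge0 // sqrtr_sqr ger0_norm.
Qed.

(** The remainder is homogeneous in the increment, so a tolerance [e / (pair_norm H h + 1)] becomes
    [t e] along the ray; the [+ 1] covers the zero direction. *)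
Lemma gradient_line f A u gA gu H h (e : R) :
  is_gradient dot f A u gA gu -> H^T = H -> 0 < e ->
  exists2 t0, 0 < t0 & forall t, 0 < t < t0 ->
    `|f (A + t *: H) (u + t *: h) - f A u - t * (frob_dot gA H + dot gu h)| <= t * e.
Proof.
move=> [_ grad] symH e0.
have p0 : 0 < pair_norm H h + 1 by rewrite ltr_wpDl // sqrtr_ge0.
have /grad /nbhs_norm0P [r r0 rP] : 0 < e / (pair_norm H h + 1) by rewrite divr_gt0.
have N0 : 0 < `|(H, h)| + 1 by rewrite ltr_wpDl.
exists (r / (`|(H, h)| + 1)); first by rewrite divr_gt0.
move=> t /andP[t0 tr].
have /rP/= : `|t *: (H, h)| < r.
  rewrite normrZ gtr0_norm //; apply: le_lt_trans (_ : t * (`|(H, h)| + 1) < r).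
    by rewrite (ler_wpM2l (ltW t0)) // lerDl.
  by rewrite -ltr_pdivlMr.
rewrite linearZ /= symH => /(_ erefl).
rewrite frob_dotC frob_dotZl frob_dotC dotC dotZl dotC -mulrDr => /le_trans; apply.
rewrite (pair_normZ _ _ (ltW t0)) mulrCA (ler_wpM2l (ltW t0)) //.
by rewrite mulrAC ler_pdivrMr // (ler_wpM2l (ltW e0)) // lerDl.
Qed.

(** Dividing by a small [t] makes the remainder arbitrarily small. This lemma and its mirror image
    turn convexity, concavity and optimality into statements on gradients. *)
Lemma gradient_slope_le f A u gA gu H h (D : R) :
  is_gradient dot f A u gA gu -> H^T = H ->
  (forall t, 0 < t <= 1 -> f (A + t *: H) (u + t *: h) <= f A u + t * D) ->
  frob_dot gA H + dot gu h <= D.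
Proof.
move=> grad symH le; apply/ler_addgt0Pr => e e0.
have [t0 t00 tP] := gradient_line h grad symH e0.
pose t := Num.min 1 (t0 / 2).
have tt0 : 0 < t < t0.
  rewrite lt_min ltr01 divr_gt0 //= gt_min ltr_pdivrMr // ltr_pMr //.
  by rewrite ltr1n orbT.
have t1 : 0 < t <= 1 by case/andP: tt0 => -> _; rewrite ge_min lexx.
have /ler_normlP[h1 _] := tP _ tt0; have h2 := le _ t1.
case/andP: t1 => tpos _; rewrite -(ler_pM2l tpos); lra.
Qed.

Lemma gradient_slope_ge f A u gA gu H h (D : R) :
  is_gradient dot f A u gA gu -> H^T = H ->
  (forall t, 0 < t <= 1 -> f A u + t * D <= f (A + t *: H) (u + t *: h)) ->
  D <= frob_dot gA H + dot gu h.
Proof.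
move=> grad symH le; apply/ler_addgt0Pr => e e0.
have [t0 t00 tP] := gradient_line h grad symH e0.
pose t := Num.min 1 (t0 / 2).
have tt0 : 0 < t < t0.
  rewrite lt_min ltr01 divr_gt0 //= gt_min ltr_pdivrMr // ltr_pMr //.
  by rewrite ltr1n orbT.
have t1 : 0 < t <= 1 by case/andP: tt0 => -> _; rewrite ge_min lexx.
have /ler_normlP[_ h1] := tP _ tt0; have h2 := le _ t1.
case/andP: t1 => tpos _; rewrite -(ler_pM2l tpos); lra.
Qed.

Lemma frob_norm_le H : H^T = H -> frob_norm H <= n%:R * `|H|.
Proof.
move=> symH; have Hij i j : `|H i j| <= `|H|.
  rewrite [leRHS]mx_normrE.
  by apply/bigmax_geP; right; exists (i, j).
rewrite -ler_sqr ?nnegrE ?mulr_ge0 ?frob_norm_ge0 // sqr_frob_norm //.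
rewrite frob_dot_symE //.
apply: (@le_trans _ _ (\sum_(i < n) \sum_(j < n) `|H| ^+ 2)).
  apply: ler_sum => i _; apply: ler_sum => j _.
  by rewrite -[_ ^+ 2]real_normK ?num_real // lerXn2r ?nnegrE.
by rewrite !sumr_const !card_ord exprMn -mulrnA -[leLHS]mulr_natr natrM mulrC -expr2.
Qed.

(** The remainder with tolerance 1 explains both [+ 1]; the factor [n] converts the entrywise
    maximum norm, which defines the topology of matrices, into the Frobenius norm. *)
Lemma gradient_near_lipschitz f A u gA gu :
  is_gradient dot f A u gA gu ->
  exists2 C, 0 < C & \forall h \near (0 : 'M[R]_n * V), h.1^T = h.1 ->
    `|f (A + h.1) (u + h.2) - f A u| <= C * `|h|.
Proof.
move=> [symg grad]; pose C1 := (frob_norm gA + 1) * n%:R.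
have C1_ge0 : 0 <= C1 by rewrite mulr_ge0 // addr_ge0 // frob_norm_ge0.
exists (C1 + (`|gu| + 1)); first by rewrite ltr_wpDl // ltr_wpDl.
have := grad 1 ltr01; apply: filterS => -[H h] /= le1 symH.
have {}le1 := le1 symH; rewrite mul1r in le1.
have le2 := frob_cauchy_schwarz symg symH; have le3 := dot_cauchy_schwarz gu h.
have le4 := pair_norm_le H h.
have le5 := frob_norm_le symH.
rewrite prod_normE /=; set N := Num.max _ _.
have HN : `|H| <= N by rewrite le_max lexx.
have hN : `|h| <= N by rewrite le_max lexx orbT.
have -> : f (A + H) (u + h) - f A u =
  (f (A + H) (u + h) - f A u - (frob_dot gA H + dot gu h)) + frob_dot gA H + dot gu h.
  by ring.
apply: le_trans (ler_normD _ _) _; rewrite mulrDl.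
have : `|gu| * `|h| <= `|gu| * N by rewrite ler_wpM2l.
have : (frob_norm gA + 1) * frob_norm H <= C1 * N.
  rewrite /C1 -mulrA ler_wpM2l ?addr_ge0 ?frob_norm_ge0 //.
  by apply: le_trans le5 _; rewrite ler_wpM2l.
have := ler_normD (f (A + H) (u + h) - f A u - (frob_dot gA H + dot gu h))
  (frob_dot gA H).
lra.
Qed.

End Gradient.

(** * Compactness *)

Section Compactness.
Variables (R : realType) (n : nat).
Local Notation S := (spectrahedron R n).
Implicit Types (A B X : 'M[R]_n).

(** Testing positivity on [e_i + e_j] and [e_i - e_j] gives [2 |X_ij| <= X_ii + X_jj], and diagonal
    entries are at most the trace. *)
Lemma spectrahedron_entry_le1 X i j : S X -> `|X i j| <= 1.
Proof.
move=> [symX posX trX].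
have Xji : X j i = X i j by rewrite -{1}symX mxE.
have quad (s : R) : (((delta_mx i 0 + s *: delta_mx j 0)^T : 'rV_n) *m X *m
    (delta_mx i 0 + s *: delta_mx j 0 : 'cV_n)) 0 0 =
    X i i + 2 * s * X i j + s ^+ 2 * X j j.
  have -> : (delta_mx i 0 + s *: delta_mx j 0)^T =
      delta_mx 0 i + s *: delta_mx 0 j :> 'rV[R]_n.
    by rewrite linearD linearZ /= !trmx_delta.
  rewrite !mulmxDl !mulmxDr -!scalemxAl -!scalemxAr.
  rewrite -!rowE -!colE !mxE Xji; ring.
have diag0 k : 0 <= X k k.
  have := posX (delta_mx k 0).
  by rewrite trmx_delta -rowE -colE !mxE.
have diag1 k : X k k <= 1.
  rewrite -trX /mxtrace (bigD1 k) //= lerDl.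
  by apply: sumr_ge0 => l _.
have := posX (delta_mx i 0 + 1 *: delta_mx j 0).
have := posX (delta_mx i 0 + (-1) *: delta_mx j 0).
rewrite !quad ler_norml; have := diag1 i; have := diag1 j; lra.
Qed.

Lemma spectrahedron_norm_le1 X : S X -> `|X| <= 1.
Proof.
move=> SX; rewrite [leLHS]mx_normrE; apply/bigmax_leP; split=> // -[i j] _ /=.
exact: spectrahedron_entry_le1.
Qed.

Lemma spectrahedron_frob_norm_le X : S X -> frob_norm X <= n%:R.
Proof.
move=> SX; have [symX _ _] := SX.
apply: le_trans (frob_norm_le symX) _.
by rewrite ler_piMr //; exact: spectrahedron_norm_le1.
Qed.

Let vec_entry (i j : 'I_n) : continuous (fun v : 'rV[R]_(n * n) => vec_mx v i j).
Proof.
rewrite (_ : (fun v => _) = fun v : 'rV[R]_(n * n) => v 0 (mxvec_index i j)).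
  exact: coord_continuous.
by apply/funext => v; rewrite mxE.
Qed.

Lemma vec_mx_continuous : continuous (@vec_mx R n n).
Proof.
move=> v; apply/(@cvgrPdist_lt _ 'M[R]_n _ _ (nbhs_filter v)) => e e0.
apply/(@nbhs_normP _ 'rV[R]_(n * n)); exists e => //= w.
rewrite -raddfB; apply: le_lt_trans; rewrite [leLHS]mx_normrE.
apply/bigmax_leP; split=> // -[i j] _; rewrite [leRHS]mx_normrE.
apply/bigmax_geP; right; exists (0, mxvec_index i j) => //=.
by rewrite [vec_mx _ _ _]mxE.
Qed.

Let closed_vec_spectrahedron : closed [set v : 'rV[R]_(n * n) | S (vec_mx v)].
Proof.
rewrite (_ : [set v | _] =
  \bigcap_(ij in [set: 'I_n * 'I_n])
    [set v : 'rV[R]_(n * n) | vec_mx v ij.2 ij.1 - vec_mx v ij.1 ij.2 = 0] `&`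
  (\bigcap_(x in [set: 'cV[R]_n])
    [set v : 'rV[R]_(n * n) | 0 <= (x^T *m vec_mx v *m x) 0 0] `&`
  [set v : 'rV[R]_(n * n) | \tr (vec_mx v) = 1])).
  apply: closedI; last apply: closedI.
  - apply: closed_bigI => -[i j] _ /=.
    apply: (@preimage_closed _ _ _ [set x : R | x = 0]); last exact: closed_eq.
    by move=> v _; exact: (continuousB (@vec_entry j i v) (@vec_entry i j v)).
  - apply: closed_bigI => x _.
    apply: (@preimage_closed _ _ _ [set x : R | 0 <= x]); last exact: closed_ge.
    move=> v _; rewrite (_ : (fun v => _) = fun v : 'rV[R]_(n * n) =>
      \sum_i \sum_j x j 0 * vec_mx v j i * x i 0).
      apply: continuous_big_sum => i; apply: continuous_big_sum => j w.
      exact: (continuousM (continuousM (@cst_continuous _ _ _ w) (@vec_entry j i w))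
        (@cst_continuous _ _ _ w)).
    apply/funext => w; rewrite mxE; apply: eq_bigr => i _.
    by rewrite mxE mulr_suml; apply: eq_bigr => j _; rewrite mxE.
  - apply: (@preimage_closed _ _ _ [set x : R | x = 1]); last exact: closed_eq.
    by move=> v _; apply: continuous_big_sum => i; exact: vec_entry.
apply/seteqP; split=> v /=.
  move=> [symv posv trv]; split; last by split=> // x _; exact: posv.
  move=> [i j] _ /=; have /= := congr1 (fun N => fun_of_matrix N i j) symv.
  by rewrite [X in X = _ -> _]mxE => ->; rewrite subrr.
move=> [symv [posv trv]]; split=> //.
  apply/matrixP => i j; rewrite mxE; apply/eqP; rewrite -subr_eq0; apply/eqP.
  exact: (symv (i, j) I).
by move=> x; exact: (posv x I).
Qed.

(** Closed and bounded sets of row vectors are compact; [vec_mx] carries this to matrices. *)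
Lemma spectrahedron_compact : compact S.
Proof.
rewrite (_ : S = @vec_mx R n n @` [set v | S (vec_mx v)]).
  apply: continuous_compact; first exact/continuous_subspaceT/vec_mx_continuous.
  apply: bounded_closed_compact closed_vec_spectrahedron.
  exists 1; split=> [|M M1 v /= Sv]; first by rewrite num_real.
  apply: le_trans (ltW M1); rewrite [leLHS]mx_normrE.
  apply/bigmax_leP; split=> // -[i k] _ /=; rewrite ord1.
  case/mxvec_indexP: k => a b.
  by have := spectrahedron_entry_le1 a b Sv; rewrite mxE.
apply/seteqP; split=> [X SX|_ [v Sv <-]] //.
by exists (mxvec X); rewrite /= mxvecK.
Qed.

Variables (V : normedModType R) (dot : {dot V for idfun}).
Hypothesis dot_norm : forall u : V, `|u| = Num.sqrt (dot u u).
Variables (f : 'M[R]_n -> V -> R) (gX : 'M[R]_n -> V -> 'M[R]_n).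
Variables (gy : 'M[R]_n -> V -> V).
Hypothesis hgrad : forall A u, symmetric_matrices R n A ->
  is_gradient dot f A u (gX A u) (gy A u).

Let near_f A u (e : R) : A^T = A -> 0 < e ->
  exists2 r, 0 < r & forall H (h : V), H^T = H -> `|H| < r -> `|h| < r ->
    `|f (A + H) (u + h) - f A u| < e.
Proof.
move=> symA e0.
have [C C0 /nbhs_norm0P [r r0 rP]] := gradient_near_lipschitz dot_norm (hgrad u symA).
exists (Num.min r (e / C)); first by rewrite lt_min r0 divr_gt0.
move=> H h symH; rewrite !lt_min => /andP[Hr HC] /andP[hr hC].
have := rP (H, h); rewrite /= prod_normE /= gt_max Hr hr => /(_ isT symH).
by move/le_lt_trans; apply; rewrite mulrC -ltr_pdivlMr // gt_max HC.
Qed.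

Lemma max_over_compact (K : set V) A : K !=set0 -> compact K -> A^T = A ->
  exists2 u, K u & forall v, K v -> f A v <= f A u.
Proof.
move=> K0 cK symA; have [|u Ku uP] := @compact_EVT_max _ _ (f A) _ K0 cK.
  apply: continuous_subspaceT => u; apply/cvgrPdist_lt => e e0.
  have [r r0 rP] := near_f u symA e0; apply/nbhs_normP; exists r => //= v uv.
  have := rP 0 (v - u); rewrite trmx0 normr0 distrC uv r0 addr0 addrCA subrr addr0.
  by rewrite distrC; apply.
by exists u => [|v Kv]; [exact: set_mem|apply: uP; exact: mem_set].
Qed.

Lemma min_over_spectrahedron u : S !=set0 ->
  exists2 A, S A & forall B, S B -> f A u <= f B u.
Proof.
move=> S0.
have [|A SA AP] := @compact_EVT_min _ _ (fun B => f B u) _ S0 spectrahedron_compact.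
  (* [f] is controlled only for symmetric increments, so continuity is proved within [S]. *)
  apply/subspace_continuousP => A SA; have [symA _ _] := SA.
  apply/cvgrPdist_lt => e e0; have [r r0 rP] := near_f u symA e0.
  rewrite near_withinE; apply/(@nbhs_normP _ 'M[R]_n); exists r => //= B AB [symB' _ _].
  have := rP (B - A) 0 (symB symB' symA).
  rewrite normr0 distrC AB r0 addr0 addrCA subrr addr0.
  by rewrite distrC; apply.
by exists A => [|B SB]; [exact: set_mem|apply: AP; exact: mem_set].
Qed.

(** The supremum bounds its set only once the set is bounded above: Frobenius norms on [S] are at
    most [n], and compactness bounds [K]. *)
Lemma pair_norm_le_diameter (K : set V) A B u v : compact K ->
  S A -> S B -> K u -> K v -> pair_norm (A - B) (u - v) <= diameter n K.
Proof.
move=> cK SA SB Ku Kv; apply: ub_le_sup; last by exists A, B, u, v.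
have [M [_ MP]] := compact_bounded cK.
have KM w : K w -> `|w| <= M + 1 by apply: MP; rewrite ltrDl.
exists (n%:R + n%:R + ((M + 1) + (M + 1))).
move=> _ [X [Y [w [z [SX SY Kw Kz ->]]]]]; apply: le_trans (pair_norm_le _ _) _.
have [symX _ _] := SX; have [symY _ _] := SY.
apply: lerD; last by apply: le_trans (ler_normB _ _) _; apply: lerD; exact: KM.
apply: le_trans (frob_normD symX _) _; first by rewrite linearN /= symY.
by rewrite frob_normN; apply: lerD; exact: spectrahedron_frob_norm_le.
Qed.

End Compactness.

(** * Iterates of the extragradient method *)

(** The two terms of the maximum are [rank_gap] with test rank [k = rt], [s = r - rt + 1], and with
    [k = 1], [s = r]. *)
Lemma truncation_gap (R : realType) (n : nat) (G Xs M : 'M[R]_n) (r : 'I_n)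
    (eta eps : R) :
  G^T = G -> spectrahedron R n Xs ->
  (forall B, spectrahedron R n B -> 0 <= frob_dot G (B - Xs)) ->
  (min_eig_mult G <= r)%N -> 0 <= eta ->
  frob_norm (M - (Xs - eta *: G)) <= eps ->
  eps <= eta * Num.max
    (Num.sqrt (min_eig_mult G)%:R * eig_gap G (r - min_eig_mult G + 1)%N / 2)
    (eig_gap G r / (1 + 1 / Num.sqrt (min_eig_mult G)%:R)) ->
  forall U d, eigen_decomposition M U d ->
    1 <= \sum_(i < n | (i < r)%N) (d 0 i - d 0 r).
Proof.
move=> symG SXs opt rtr eta0 closeM epsle U d decM.
have [W [g decG]] := symmetric_eigen_decomposition symG.
have [WW gmon _] := decG.
have n0 : (0 < n)%N := leq_ltn_trans (leq0n r) (ltn_ord r).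
have mlt : (n.-1 < n)%N by rewrite prednK.
pose m : 'I_n := Ordinal mlt.
have mn : m.+1 = n by rewrite /= prednK.
have /andP[rt0 rtn] := min_eig_mult_bounds decG mn.
set rt := min_eig_mult G in rtr epsle rt0 rtn *.
have gm i : g 0 m <= g 0 i by apply: gmon; rewrite -ltnS mn.
have eps0 : 0 <= eps by apply: le_trans closeM; exact: frob_norm_ge0.
have srt : 0 < Num.sqrt rt%:R :> R by rewrite sqrtr_gt0 ltr0n.
have rtE : rt%:R = Num.sqrt rt%:R * Num.sqrt rt%:R :> R.
  by rewrite -expr2 sqr_sqrtr // ler0n.
(* The 1-based index [n - s] of [lambda] is the 0-based index [j] of [g], hence [j.+1]. *)
have gapE s (j : 'I_n) : (j.+1 + s = n)%N -> eig_gap G s = g 0 j - g 0 m.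
  move=> js; have := lambda_eigen_decomposition m decG; rewrite mn => lm.
  rewrite /eig_gap lm; have -> : (n - s = j.+1)%N by lia.
  by rewrite (lambda_eigen_decomposition _ decG).
have gap_ge0 s : (s < n)%N -> 0 <= eig_gap G s.
  move=> sn; have jn : ((n - s).-1 < n)%N by lia.
  by rewrite (gapE s (Ordinal jn)) ?subr_ge0 //=; lia.
have rn := ltn_ord r.
(* With [j = n - s - 1], the relation [s + k = r + 1] makes the dimension count an equality, and
   [rt <= s] keeps [g_j] off the smallest eigenvalue. *)
have conclude k s : (0 < k)%N -> (s + k = r.+1)%N -> (rt <= s)%N ->
    eps * (Num.sqrt rt%:R + rt%:R / Num.sqrt k%:R) <= rt%:R * (eta * eig_gap G s) ->
    1 <= \sum_(i < n | (i < r)%N) (d 0 i - d 0 r).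
  move=> k0 sk rts; have jn : ((n - s).-1 < n)%N by lia.
  rewrite (gapE s (Ordinal jn)) /=; last by lia.
  by apply: (rank_gap decG mn SXs opt decM eta0 closeM k0) => /=; rewrite -/rt; lia.
have second : eps <= eta * (eig_gap G r / (1 + 1 / Num.sqrt rt%:R)) ->
    1 <= \sum_(i < n | (i < r)%N) (d 0 i - d 0 r).
  move=> h; apply: (conclude 1%N r) => //; first by rewrite addn1.
  rewrite sqrtr1 divr1; move: h; rewrite mulrA ler_pdivlMr; last first.
    by rewrite addr_gt0 // divr_gt0.
  have rts : rt%:R * (1 / Num.sqrt rt%:R) = Num.sqrt rt%:R :> R.
    by rewrite mul1r {1}rtE mulfK ?gt_eqF.
  by move=> h; have := ler_wpM2l (ler0n R rt) h; rewrite mulrCA mulrDr rts; lra.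
move: epsle; rewrite maxr_pMr // le_max => /orP[|] // h.
have [rts|srt'] := leqP rt (r - rt + 1).
  apply: (conclude rt (r - rt + 1)%N) => //; first by lia.
  rewrite {2}rtE mulfK ?gt_eqF //.
  by rewrite [X in _ <= X * _]rtE; have := ler_wpM2l (ltW srt) h; lra.
(* When [r - rt + 1 < rt], the index falls among the copies of the smallest eigenvalue, so this gap
   is 0 and the second term dominates. *)
apply: second; apply: le_trans h _.
have jn : ((n - (r - rt + 1)).-1 < n)%N by lia.
rewrite (gapE _ (Ordinal jn)) /=; last by lia.
have -> : g 0 (Ordinal jn) = g 0 m.
  apply/le_anti; rewrite gm andbT leNgt -(min_eig_mult_ltn _ mn decG) /=.
  by rewrite -/rt -leqNgt; lia.
by rewrite subrr mulr0 mul0r mulr0 mulr_ge0 // divr_ge0 ?gap_ge0 //.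
Qed.

(** * Descent of the extragradient step, averaged duality gap and distance to the saddle point *)

Section Extragradient.
Variables (R : realType) (n : nat) (V : normedModType R).
Variables (dot : {dot V for idfun}).
Hypothesis dot_norm : forall u : V, `|u| = Num.sqrt (dot u u).
Variables (K : set V).
Hypothesis Kconvex : convex_set K.
Variables (f : 'M[R]_n -> V -> R).
Variables (gX : 'M[R]_n -> V -> 'M[R]_n) (gy : 'M[R]_n -> V -> V).
Hypothesis hgrad : forall A u, symmetric_matrices R n A ->
  is_gradient dot f A u (gX A u) (gy A u).
Hypothesis hconvex : forall u, K u ->
  convex_function (symmetric_matrices R n) (fun A => f A u).
Hypothesis hconcave : forall A, spectrahedron R n A ->
  convex_function K (fun u => - f A u).
Variables (bX by_ bXy byX : R).
Hypotheses (bX0 : 0 <= bX) (by0 : 0 <= by_) (bXy0 : 0 <= bXy) (byX0 : 0 <= byX).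
Local Notation S := (spectrahedron R n).
Hypothesis hbX : forall A B u, S A -> S B -> K u ->
  frob_norm (gX A u - gX B u) <= bX * frob_norm (A - B).
Hypothesis hby : forall A u v, S A -> K u -> K v ->
  `|gy A u - gy A v| <= by_ * `|u - v|.
Hypothesis hbXy : forall A u v, S A -> K u -> K v ->
  frob_norm (gX A u - gX A v) <= bXy * `|u - v|.
Hypothesis hbyX : forall A B u, S A -> S B -> K u ->
  `|gy A u - gy B u| <= byX * frob_norm (A - B).

Lemma symmetric_matrices_convex : convex_set (symmetric_matrices R n).
Proof.
move=> A B t /set_mem sA /set_mem sB; apply/mem_set.
by apply: symD; exact: symZ.
Qed.

Lemma gradient_convex A B u : A^T = A -> B^T = B -> K u ->
  f A u + frob_dot (gX A u) (B - A) <= f B u.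
Proof.
move=> sA sB Ku; rewrite -lerBrDl.
have := @gradient_slope_le _ _ _ dot f A u _ _ (B - A) 0 (f B u - f A u)
  (hgrad u sA) (symB sB sA).
have -> : dot (gy A u) 0 = 0 by rewrite dotC -(scale0r (0 : V)) dotZl mul0r.
rewrite addr0; apply => t /andP[t0 t1]; rewrite scaler0 addr0.
by apply: (convex_function_segment (hconvex Ku)) => //; rewrite (ltW t0).
Qed.

Lemma gradient_concave A u v : S A -> K u -> K v ->
  f A v <= f A u + dot (gy A u) (v - u).
Proof.
move=> SA Ku Kv; have [sA _ _] := SA; rewrite -lerBlDl.
have := @gradient_slope_ge _ _ _ dot f A u _ _ 0 (v - u) (f A v - f A u)
  (hgrad u sA) (trmx0 _ _ _).
have -> : frob_dot (gX A u) 0 = 0 by rewrite /frob_dot mulmx0 mxtrace0.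
rewrite add0r; apply => t /andP[t0 t1]; rewrite scaler0 addr0.
have := convex_function_segment (hconcave SA) Ku Kv (t := t).
by rewrite (ltW t0) t1 => /(_ isT); lra.
Qed.

(** Adding the gradient inequality of [f(., u)] at [A] to that of [f(A, .)] at [u] cancels
    [f A u]. *)
Lemma gap_le_operator A B u v : S A -> S B -> K u -> K v ->
  f A v - f B u <= frob_dot (gX A u) (A - B) - dot (gy A u) (u - v).
Proof.
move=> SA SB Ku Kv; have [sA _ _] := SA; have [sB _ _] := SB.
have := gradient_convex sA sB Ku; have := gradient_concave SA Ku Kv.
have -> : dot (gy A u) (v - u) = - dot (gy A u) (u - v).
  by rewrite dotC -opprB -scaleN1r dotZl mulN1r dotC.
rewrite !frob_dotBr; lra.
Qed.

Lemma saddle_variational Xs ys : saddle_point K f Xs ys ->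
  forall B, S B -> 0 <= frob_dot (gX Xs ys) (B - Xs).
Proof.
case=> SX Ky _ minX B SB; have [sX _ _] := SX; have [sB _ _] := SB.
have := @gradient_slope_ge _ _ _ dot f Xs ys _ _ (B - Xs) 0 0
  (hgrad ys sX) (symB sB sX).
have -> : dot (gy Xs ys) 0 = 0 by rewrite dotC -(scale0r (0 : V)) dotZl mul0r.
rewrite addr0; apply => t /andP[t0 t1]; rewrite scaler0 mulr0 !addr0.
by apply: minX; apply: spectrahedron_convex => //; rewrite (ltW t0).
Qed.

Lemma gX_lipschitz A B u v : S A -> S B -> K u -> K v ->
  frob_norm (gX A u - gX B v) <= bX * frob_norm (A - B) + bXy * `|u - v|.
Proof.
move=> SA SB Ku Kv; have [sA _ _] := SA; have [sB _ _] := SB.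
have sg C w : C^T = C -> (gX C w)^T = gX C w by move=> sC; have [] := hgrad w sC.
have -> : gX A u - gX B v = (gX A u - gX B u) + (gX B u - gX B v).
  by rewrite addrA subrK.
apply: le_trans (frob_normD _ _) _; try by apply: symB; exact: sg.
by apply: lerD; [exact: hbX|exact: hbXy].
Qed.

Lemma gy_lipschitz A B u v : S A -> S B -> K u -> K v ->
  `|gy A u - gy B v| <= by_ * `|u - v| + byX * frob_norm (A - B).
Proof.
move=> SA SB Ku Kv.
have -> : gy A u - gy B v = (gy A u - gy A v) + (gy A v - gy B v).
  by rewrite addrA subrK.
apply: le_trans (ler_normD _ _) _.
by apply: lerD; [exact: hby|exact: hbyX].
Qed.

Variable eta : R.
Hypothesis eta_gt0 : 0 < eta.
Hypothesis etaX : 4 * eta ^+ 2 * (bX ^+ 2 + byX ^+ 2) <= 1.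
Hypothesis etay : 4 * eta ^+ 2 * (by_ ^+ 2 + bXy ^+ 2) <= 1.

Let W := ('M[R]_n * V)%type.
Let ip (z z' : W) : R := frob_dot z.1 z'.1 + dot z.2 z'.2.
(** The sign makes the ascent in [y] a descent, so both updates are projections of the form
    [z - eta F]. *)
Let F (z : W) : W := (gX z.1 z.2, - gy z.1 z.2).
Let C : set W := [set z | S z.1 /\ K z.2].

Let ipC z z' : ip z z' = ip z' z.
Proof. by rewrite /ip frob_dotC dotC. Qed.

Let ipDl x y z : ip (x + y) z = ip x z + ip y z.
Proof. by rewrite /ip frob_dotDl dotDl; ring. Qed.

Let ipZl a x y : ip (a *: x) y = a * ip x y.
Proof. by rewrite /ip frob_dotZl dotZl mulrDr. Qed.

Let ip_ge0 z : z.1^T = z.1 -> 0 <= ip z z.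
Proof. by move=> sz; rewrite addr_ge0 ?frob_dot_ge0 ?dot_ge0. Qed.

Let ipE z : z.1^T = z.1 -> ip z z = frob_norm z.1 ^+ 2 + `|z.2| ^+ 2.
Proof. by move=> sz; rewrite /ip sqr_frob_norm // (sqr_dot_norm dot_norm). Qed.

Let Csym z : C z -> z.1^T = z.1.
Proof. by case=> [[]]. Qed.

Let Fsym z : C z -> (F z).1^T = (F z).1.
Proof. by move=> /Csym sz; have [] := hgrad z.2 sz. Qed.

(** Each Lipschitz bound is squared with [(p + q)^2 <= 2 (p^2 + q^2)]. The coefficients of the two
    squared distances then group as in [etaX] and [etay], which leave the factor 1/2. *)
Let F_lipschitz z u : C z -> C u ->
  eta ^+ 2 * ip (F z - F u) (F z - F u) <= ip (z - u) (z - u) / 2.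
Proof.
move=> Cz Cu; have [Sz Kz] := Cz; have [Su Ku] := Cu.
rewrite !ipE; try by apply: symB; [exact: Csym|exact: Csym].
  have /= := gX_lipschitz Sz Su Kz Ku; have /= := gy_lipschitz Sz Su Kz Ku.
  rewrite -opprD normrN.
  have := frob_norm_ge0 (z.1 - u.1); have := normr_ge0 (z.2 - u.2).
  have := frob_norm_ge0 (gX z.1 z.2 - gX u.1 u.2).
  have := normr_ge0 (gy z.1 z.2 - gy u.1 u.2).
  move: (frob_norm (z.1 - u.1)) `|z.2 - u.2| (frob_norm _) `|_| => a b p q.
  move=> q0 p0 b0 a0 qle ple.
  have psq : p ^+ 2 <= 2 * (bX ^+ 2 * a ^+ 2 + bXy ^+ 2 * b ^+ 2).
    apply: (@le_trans _ _ ((bX * a + bXy * b) ^+ 2)).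
      by rewrite lerXn2r ?nnegrE ?addr_ge0 ?mulr_ge0.
    by have := sqr_ge0 (bX * a - bXy * b); nra.
  have qsq : q ^+ 2 <= 2 * (by_ ^+ 2 * b ^+ 2 + byX ^+ 2 * a ^+ 2).
    apply: (@le_trans _ _ ((by_ * b + byX * a) ^+ 2)).
      by rewrite lerXn2r ?nnegrE ?addr_ge0 ?mulr_ge0.
    by have := sqr_ge0 (by_ * b - byX * a); nra.
  have := ler_wpM2r (sqr_ge0 a) etaX; have := ler_wpM2r (sqr_ge0 b) etay.
  have := ler_wpM2l (sqr_ge0 eta) (lerD psq qsq); lra.
by apply: symB; exact: Fsym.
Qed.

Let proj_pair z g p :
  z.1^T = z.1 -> g.1^T = g.1 ->
  is_frob_proj S (z.1 - eta *: g.1) p.1 -> is_proj K (z.2 - eta *: g.2) p.2 ->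
  C p /\ forall Q, C Q ->
    ip (z - eta *: g - p) (z - eta *: g - p) <= ip (z - eta *: g - Q) (z - eta *: g - Q).
Proof.
move=> sz sg [Sp minp] [Kp minp2]; split=> // Q [SQ KQ].
have sY : (z.1 - eta *: g.1)^T = z.1 - eta *: g.1 by apply: symB => //; exact: symZ.
have [sp _ _] := Sp; have [sQ _ _] := SQ.
rewrite !ipE; try exact: symB.
apply: lerD; first by rewrite lerXn2r ?nnegrE ?frob_norm_ge0 ?minp.
by rewrite lerXn2r ?nnegrE ?minp2.
Qed.

Let Cconvex P Q (t : R) : C P -> C Q -> 0 <= t <= 1 -> C (P + t *: (Q - P)).
Proof.
move=> [SP KP] [SQ KQ] t01; split; first exact: spectrahedron_convex.
exact: convex_set_segment.
Qed.

Variables (X : nat -> 'M[R]_n) (y : nat -> V) (Z : nat -> 'M[R]_n) (w : nat -> V).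
Hypothesis hiter : extragradient K gX gy eta X y Z w.

Let z t : W := (X t, y t).
Let u t : W := (Z t, w t).

Lemma iterates_mem t : (1 <= t)%N -> S (X t) /\ K (y t).
Proof.
case: hiter => SX1 Ky1 step; case: t => // -[|t] _ //.
by have [//|_ _ [SX _] [Ky _]] := step t.+1.
Qed.

Lemma extrapolated_mem t : (1 <= t)%N -> S (Z t.+1) /\ K (w t.+1).
Proof. by case: hiter => _ _ step /step [[SZ _] [Kw _] _ _]. Qed.

Let descent t q : (1 <= t)%N -> C q ->
  ip (z t.+1 - q) (z t.+1 - q) + ip (z t - u t.+1) (z t - u t.+1) / 2
    + 2 * (eta * ip (F (u t.+1)) (u t.+1 - q)) <= ip (z t - q) (z t - q).
Proof.
move=> t1 Cq; have [_ _ /(_ t t1) [pZ pw pX py]] := hiter.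
have Cz : C (z t) := iterates_mem t1.
have Cu : C (u t.+1) := extrapolated_mem t1.
have Cz' : C (z t.+1) := iterates_mem (leqW t1).
have [|_ minu] := proj_pair (z := z t) (g := F (z t)) (p := u t.+1)
  (Csym Cz) (Fsym Cz) pZ; first by rewrite /= scalerN opprK.
have [|_ minz] := proj_pair (z := z t) (g := F (u t.+1)) (p := z t.+1)
  (Csym Cz) (Fsym Cu) pX; first by rewrite /= scalerN opprK.
apply: (extragradient_descent ipC ipDl ipZl Cconvex Cu minu Cz' minz _ _ Cq).
  apply: ip_ge0; apply: symD.
    by apply: symZ; apply: symB; exact: Fsym.
  by apply: symB; exact: Csym.
exact: F_lipschitz.
Qed.

Lemma average_gap_le (D : R) (B : 'M[R]_n) (v : V) (T : nat) :
  S B -> K v -> pair_norm (X 1%N - B) (y 1%N - v) <= D -> (1 <= T)%N ->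
  f (T%:R^-1 *: \sum_(1 <= t < T.+1) Z t.+1) v -
    f B (T%:R^-1 *: \sum_(1 <= t < T.+1) w t.+1) <=
  D ^+ 2 / (2 * eta) / T%:R.
Proof.
move=> SB Kv dist T1; pose q : W := (B, v).
have Cq : C q by [].
have gap t : (1 <= t)%N -> f (Z t.+1) v - f B (w t.+1) <= ip (F (u t.+1)) (u t.+1 - q).
  move=> t1; have [SZ Kw] := extrapolated_mem t1.
  apply: le_trans (gap_le_operator SZ SB Kw Kv) _.
  by rewrite /ip /= -[- gy _ _]scaleN1r dotZl mulN1r.
(* The descent inequalities telescope; their terms [|z - u|^2 / 2] are nonnegative and dropped. *)
have tele s : ip (z s.+1 - q) (z s.+1 - q) +
    2 * eta * \sum_(1 <= t < s.+1) (f (Z t.+1) v - f B (w t.+1)) <=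
    ip (z 1 - q) (z 1 - q).
  elim: s => [|s IHs]; first by rewrite big_nil mulr0 addr0.
  rewrite big_nat_recr //=; have := descent (isT : (1 <= s.+1)%N) Cq.
  have : 0 <= ip (z s.+1 - u s.+2) (z s.+1 - u s.+2).
    apply: ip_ge0; apply: symB; apply: Csym; first exact: iterates_mem.
    exact: extrapolated_mem.
  have := ler_wpM2l (ltW eta_gt0) (gap s.+1 isT).
  move: IHs; lra.
have D0 : 0 <= D by apply: le_trans dist; exact: sqrtr_ge0.
have zD : ip (z 1 - q) (z 1 - q) <= D ^+ 2.
  have [symX1 symBs] : (X 1%N)^T = X 1%N /\ B^T = B.
    by have [[]] := iterates_mem (isT : (1 <= 1)%N); case: SB.
  rewrite ipE; last exact: symB.
  have := dist; rewrite -ler_sqr ?nnegrE ?sqrtr_ge0 // sqr_sqrtr //.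
  by rewrite addr_ge0 // sqr_ge0.
have zT0 : 0 <= ip (z T.+1 - q) (z T.+1 - q).
  by apply: ip_ge0; apply: symB; apply: Csym => //; exact: iterates_mem.
have symZ' t : (1 <= t)%N -> symmetric_matrices R n (Z t.+1).
  by move=> /extrapolated_mem [[]].
have Kw t : (1 <= t)%N -> K (w t.+1) by move=> /extrapolated_mem [].
have [_ jZ] := jensen_average symmetric_matrices_convex (hconvex Kv) symZ' T1.
have [_ jw] := jensen_average Kconvex (hconcave SB) Kw T1.
apply: (@le_trans _ _ (T%:R^-1 * \sum_(1 <= t < T.+1) (f (Z t.+1) v - f B (w t.+1)))).
  by rewrite sumrB mulrBr; move: jw; rewrite sumrN mulrN; move: jZ; lra.
rewrite mulrC ler_wpM2r ?invr_ge0 // ler_pdivlMr ?mulr_gt0 // mulrC.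
by have := tele T; lra.
Qed.

Variables (Xs : 'M[R]_n) (ys : V).
Hypothesis hsaddle : saddle_point K f Xs ys.

Let zs : W := (Xs, ys).

Let Czs : C zs. Proof. by case: hsaddle. Qed.

(** The saddle value lies between [f(Xs, w)] and [f(Z, ys)], so the gap bounded by the operator term
    is nonnegative. *)
Let operator_ge0 t : (1 <= t)%N -> 0 <= ip (F (u t.+1)) (u t.+1 - zs).
Proof.
move=> t1; have [SZ Kw] := extrapolated_mem t1.
have [SX Ky maxy minX] := hsaddle.
have := gap_le_operator SZ SX Kw Ky.
have := maxy _ Kw; have := minX _ SZ.
rewrite /ip /= -[- gy _ _]scaleN1r dotZl mulN1r; lra.
Qed.

Let fejer t : (1 <= t)%N ->
  ip (z t.+1 - zs) (z t.+1 - zs) + ip (z t - u t.+1) (z t - u t.+1) / 2 <=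
  ip (z t - zs) (z t - zs).
Proof.
move=> t1; have := descent t1 Czs.
have := mulr_ge0 (ltW eta_gt0) (operator_ge0 t1); lra.
Qed.

Variable rho : R.
Hypothesis hinit : pair_norm (X 1%N - Xs) (y 1%N - ys) <= rho.

Let rho0 : 0 <= rho.
Proof. by apply: le_trans hinit; exact: sqrtr_ge0. Qed.

Let z_close t : (1 <= t)%N -> ip (z t - zs) (z t - zs) <= rho ^+ 2.
Proof.
case: t => // t _; elim: t => [|t IHt].
  rewrite ipE; last by apply: symB; apply: Csym => //; exact: iterates_mem.
  have := hinit; rewrite -ler_sqr ?nnegrE ?sqrtr_ge0 // sqr_sqrtr //.
  by rewrite addr_ge0 // sqr_ge0.
have := fejer (isT : (1 <= t.+1)%N).
have : 0 <= ip (z t.+1 - u t.+2) (z t.+1 - u t.+2).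
  apply: ip_ge0; apply: symB; apply: Csym; first exact: iterates_mem.
  exact: extrapolated_mem.
move: IHt; lra.
Qed.

(* With |u - z| <= sqrt 2 |z - z*|, the triangle inequality gives
   |u - z*| <= (1 + sqrt 2) |z - z*|. *)
Let u_close t : (1 <= t)%N ->
  ip (u t.+1 - zs) (u t.+1 - zs) <= ((1 + Num.sqrt 2) * rho) ^+ 2.
Proof.
move=> t1; have Cz : C (z t) := iterates_mem t1.
have Cu : C (u t.+1) := extrapolated_mem t1.
have zt := z_close t1; have := fejer t1.
have : 0 <= ip (z t.+1 - zs) (z t.+1 - zs).
  by apply: ip_ge0; apply: symB; apply: Csym => //; exact: iterates_mem.
have -> : u t.+1 - zs = (z t - zs) - (z t - u t.+1).
  by rewrite opprB [RHS]addrC addrA subrK.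
(* With [x = z - zs] and [d = z - u], this square and [|d|^2 <= 2 |x|^2] give
   [-<x, d> <= sqrt 2 rho^2], which controls the cross term of [|x - d|^2]. *)
have : 0 <= ip (Num.sqrt 2 *: (z t - zs) + (z t - u t.+1))
                (Num.sqrt 2 *: (z t - zs) + (z t - u t.+1)).
  by apply: ip_ge0; apply: symD; [apply: symZ|]; apply: symB; exact: Csym.
move: zt; move: (z t - zs) (z t - u t.+1) => x d.
rewrite !(ip_linear ipC ipDl ipZl) (ipC d x).
have := @sqr_sqrtr R 2 (ler0n _ _); have := sqrtr_ge0 (2 : R).
move: (Num.sqrt 2) => s s0 ss hx h z0 hd.
have s1 : 0 < s by nra.
have : s * (- ip x d) <= s * (s * rho ^+ 2) by nra.
by rewrite ler_pM2l //; nra.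
Qed.

Let norm_sum_le (A : 'M[R]_n) (v : V) (c : R) : 0 <= c ->
  A^T = A -> frob_norm A ^+ 2 + `|v| ^+ 2 <= c ^+ 2 ->
  frob_norm A <= c /\ frob_norm A + `|v| <= Num.sqrt 2 * c.
Proof.
move=> c0 sA le; have := frob_norm_ge0 A; have := normr_ge0 v.
move: (frob_norm A) `|v| le => a b le b0 a0; split.
  by rewrite -ler_sqr ?nnegrE //; have := sqr_ge0 b; lra.
rewrite -ler_sqr ?nnegrE ?addr_ge0 ?mulr_ge0 ?sqrtr_ge0 // exprMn sqr_sqrtr //.
by have := sqr_ge0 (a - b); nra.
Qed.

Lemma step_matrix_close t : (1 <= t)%N ->
  let eps := rho * (1 + (2 + Num.sqrt 2) * eta * Num.max bX bXy) in
  frob_norm (X t - eta *: gX (X t) (y t) - (Xs - eta *: gX Xs ys)) <= eps /\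
  frob_norm (X t - eta *: gX (Z t.+1) (w t.+1) - (Xs - eta *: gX Xs ys)) <= eps.
Proof.
move=> t1 eps; have Cz : C (z t) := iterates_mem t1.
have Cu : C (u t.+1) := extrapolated_mem t1.
have s2 := sqrtr_ge0 (2 : R); have ss := @sqr_sqrtr R 2 (ler0n _ _).
have dz := z_close t1; rewrite ipE in dz; last by apply: symB; exact: Csym.
have [|az abz] := norm_sum_le rho0 _ dz; first by apply: symB; exact: Csym.
have du := u_close t1; rewrite ipE in du; last by apply: symB; exact: Csym.
have [||_ abu] := norm_sum_le _ _ du.
- by rewrite mulr_ge0 // addr_ge0.
- by apply: symB; exact: Csym.
(* The constant is [2 + sqrt 2 = sqrt 2 (1 + sqrt 2)]: [1 + sqrt 2] is the distance factor of the
   extrapolated point, and [sqrt 2] passes from the pair norm to the sum of norms. For [z] itself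
   the smaller [sqrt 2] suffices. *)
have bound (p : W) : C p ->
    frob_norm (p.1 - Xs) + `|p.2 - ys| <= (2 + Num.sqrt 2) * rho ->
    frob_norm (X t - eta *: gX p.1 p.2 - (Xs - eta *: gX Xs ys)) <= eps.
  move=> Cp ab; have [Sp Kp] := Cp; have [SX Ky] := Czs.
  have -> : X t - eta *: gX p.1 p.2 - (Xs - eta *: gX Xs ys) =
      (X t - Xs) + - (eta *: (gX p.1 p.2 - gX Xs ys)).
    by apply/matrixP => i j; rewrite !mxE; ring.
  have sg : (gX p.1 p.2 - gX Xs ys)^T = gX p.1 p.2 - gX Xs ys.
    by apply: symB; [exact: (Fsym Cp)|exact: (Fsym Czs)].
  apply: le_trans (frob_normD _ _) _.
  - by apply: symB; [exact: (Csym Cz)|exact: (Csym Czs)].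
  - by rewrite -scaleN1r; apply: symZ; exact: symZ.
  rewrite frob_normN (frob_normZ _ (ltW eta_gt0)) /eps mulrDr mulr1.
  apply: lerD => //.
  have /= := gX_lipschitz Sp SX Kp Ky; have := ab.
  have := frob_norm_ge0 (p.1 - Xs); have := normr_ge0 (p.2 - ys).
  move: (frob_norm (p.1 - Xs)) `|p.2 - ys|
    (frob_norm (gX p.1 p.2 - gX Xs ys)) => a b g b0 a0 {}ab gle.
  have mX : bX <= Num.max bX bXy by rewrite le_max lexx.
  have mXy : bXy <= Num.max bX bXy by rewrite le_max lexx orbT.
  move: (Num.max bX bXy) mX mXy => mx mX mXy.
  have mx0 : 0 <= mx := le_trans bX0 mX.
  have g1 : g <= mx * (a + b).
    apply: le_trans gle _; rewrite mulrDr; apply: lerD; exact: ler_wpM2r.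
  have g2 : g <= mx * ((2 + Num.sqrt 2) * rho).
    by apply: le_trans g1 _; exact: ler_wpM2l.
  have := ler_wpM2l (ltW eta_gt0) g2; lra.
split.
  apply: (bound (z t) Cz); apply: le_trans abz _.
  by rewrite ler_wpM2r // lerDr.
apply: (bound (u t.+1) Cu); apply: le_trans abu _.
by rewrite mulrA ler_wpM2r //; nra.
Qed.

End Extragradient.

Theorem theorem1 (R : realType) (n : nat)
    (V : normedModType R) (dot : {dot V for idfun})
    (hV : euclidean_space dot)
    (K : set V) (K0 : K !=set0) (Kcompact : compact K) (Kconvex : convex_set K)
    (f : 'M[R]_n -> V -> R)
    (gX : 'M[R]_n -> V -> 'M[R]_n) (gy : 'M[R]_n -> V -> V)
    (hgrad : forall A u, symmetric_matrices R n A ->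
       is_gradient dot f A u (gX A u) (gy A u))
    (hconvex : forall u, K u ->
       convex_function (symmetric_matrices R n) (fun A => f A u))
    (hconcave : forall A, spectrahedron R n A ->
       convex_function K (fun u => - f A u))
    (bX by_ bXy byX : R)
    (bX0 : 0 <= bX) (by0 : 0 <= by_) (bXy0 : 0 <= bXy) (byX0 : 0 <= byX)
    (b_neq0 : [|| bX != 0, by_ != 0, bXy != 0 | byX != 0])
    (hbX : forall A B u, spectrahedron R n A -> spectrahedron R n B -> K u ->
       frob_norm (gX A u - gX B u) <= bX * frob_norm (A - B))
    (hby : forall A u v, spectrahedron R n A -> K u -> K v ->
       `|gy A u - gy A v| <= by_ * `|u - v|)
    (hbXy : forall A u v, spectrahedron R n A -> K u -> K v ->
       frob_norm (gX A u - gX A v) <= bXy * `|u - v|)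
    (hbyX : forall A B u, spectrahedron R n A -> spectrahedron R n B -> K u ->
       `|gy A u - gy B u| <= byX * frob_norm (A - B))
    (Xs : 'M[R]_n) (ys : V) (hsaddle : saddle_point K f Xs ys)
    (r : nat) (hr : (min_eig_mult (gX Xs ys) <= r <= n - 1)%N)
    (X : nat -> 'M[R]_n) (y : nat -> V) (Z : nat -> 'M[R]_n) (w : nat -> V)
    (hiter : extragradient K gX gy (step_size bX by_ bXy byX) X y Z w)
    (hinit : pair_norm (X 1%N - Xs) (y 1%N - ys) <=
       init_radius bX bXy (step_size bX by_ bXy byX) (gX Xs ys) r) :
  let eta := step_size bX by_ bXy byX in
  (forall t, (1 <= t)%N ->
     let M := X t - eta *: gX (X t) (y t) in
     let N := X t - eta *: gX (Z t.+1) (w t.+1) in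
     [/\ truncated_proj r M (Z t.+1),
         truncated_proj r N (X t.+1),
         1 <= pos_eig_sum M -> zero_truncated_proj r M (Z t.+1)
       & 1 <= pos_eig_sum N -> zero_truncated_proj r N (X t.+1)]) /\
  (forall T, (1 <= T)%N ->
     let Zavg := T%:R^-1 *: \sum_(1 <= t < T.+1) Z t.+1 in
     let wavg := T%:R^-1 *: \sum_(1 <= t < T.+1) w t.+1 in
     exists a b : R,
       [/\ is_max [set f Zavg u | u in K] a,
           is_min [set f B wavg | B in spectrahedron R n] b
         & a - b <=
           diameter n K ^+ 2 *
           Num.max (Num.max (Num.sqrt (bX ^+ 2 + byX ^+ 2))
                            (Num.sqrt (by_ ^+ 2 + bXy ^+ 2)))
                   (Num.max ((bX + bXy) / 2) ((by_ + byX) / 2))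
           / T%:R]).
Proof.
move=> eta; have dot_norm := hV.1.
have [mu0 etaE] := step_size_eq bX0 by0 bXy0 byX0 b_neq0.
set mu := Num.max (Num.max _ _) _ in mu0 etaE.
have eta0 : 0 < eta by rewrite /eta etaE invr_gt0.
have muX : 2 * Num.sqrt (bX ^+ 2 + byX ^+ 2) <= mu by rewrite !le_max lexx.
have muy : 2 * Num.sqrt (by_ ^+ 2 + bXy ^+ 2) <= mu by rewrite !le_max lexx orbT.
have step_bound (a : R) : 0 <= a -> 2 * Num.sqrt a <= mu -> 4 * eta ^+ 2 * a <= 1.
  move=> a0 amu; rewrite -[X in _ * X <= _](sqr_sqrtr a0).
  have -> : 4 * eta ^+ 2 * Num.sqrt a ^+ 2 = ((2 * Num.sqrt a) / mu) ^+ 2.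
    by rewrite /eta etaE; ring.
  rewrite expr_le1 ?divr_ge0 ?mulr_ge0 ?sqrtr_ge0 ?(ltW mu0) //.
  by rewrite ler_pdivrMr // mul1r.
have etaX : 4 * eta ^+ 2 * (bX ^+ 2 + byX ^+ 2) <= 1.
  by apply: step_bound => //; rewrite addr_ge0 ?sqr_ge0.
have etay : 4 * eta ^+ 2 * (by_ ^+ 2 + bXy ^+ 2) <= 1.
  by apply: step_bound => //; rewrite addr_ge0 ?sqr_ge0.
have [SXs Kys _ _] := hsaddle; have [symXs _ _] := SXs.
have [symG _] := hgrad Xs ys symXs.
(* An empty matrix has trace 0, so it is not in the spectrahedron. *)
have n0 : (0 < n)%N.
  rewrite lt0n; apply/eqP => n0; have [_ _] := SXs; rewrite /mxtrace big1.
    by move/eqP; rewrite eq_sym oner_eq0.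
  by move=> i _; have := ltn_ord i; rewrite {2}n0.
case/andP: hr => rtr rn.
have r_lt : (r < n)%N by rewrite (leq_ltn_trans rn) // subn1 ltn_predL.
split=> [t t1 M N|T T1 Zavg wavg].
  set c := Num.max bX bXy; set G := gX Xs ys in rtr symG *.
  pose rho := init_radius bX bXy eta G r.
  pose mx := Num.max (Num.sqrt (min_eig_mult G)%:R *
      eig_gap G (r - min_eig_mult G + 1)%N / 2)
    (eig_gap G r / (1 + 1 / Num.sqrt (min_eig_mult G)%:R)).
  have [closeM closeN] := step_matrix_close dot_norm Kconvex hgrad hconvex hconcave
    bX0 by0 bXy0 byX0 hbX hby hbXy hbyX eta0 etaX etay hiter hsaddle hinit t1.
  rewrite -/eta -/G -/M -/N -/c in closeM closeN.
  set eps := _ * _ in closeM closeN.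
  have c0 : 0 <= c by rewrite le_max bX0.
  have s0 : 0 < 1 + Num.sqrt 2 :> R by rewrite ltr_pwDl ?sqrtr_ge0.
  have q0 : 0 < 1 + (2 + Num.sqrt 2) * eta * c.
    by rewrite ltr_pwDl // mulr_ge0 // mulr_ge0 ?(ltW eta0) // addr_ge0 ?sqrtr_ge0.
  (* The factor by which [eps] exceeds [rho] is a factor of the denominator of [init_radius]; only
     [1 + sqrt 2], which is at least 1, remains. *)
  have epsE : (1 + Num.sqrt 2) * eps = eta * mx.
    rewrite /eps /init_radius -/eta -/c -/mx.
    by field; rewrite !gt_eqF.
  have eps0 : 0 <= eps by apply: le_trans closeM; exact: frob_norm_ge0.
  have epsle : eps <= eta * mx.
    by rewrite -epsE ler_peMl // lerDl sqrtr_ge0.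
  have opt := saddle_variational hgrad hsaddle.
  have [_ _ /(_ t t1) [pZ _ pX _]] := hiter.
  have gap L : frob_norm (L - (Xs - eta *: G)) <= eps ->
      forall U d, eigen_decomposition L U d ->
      1 <= \sum_(i < n | (i < Ordinal r_lt)%N) (d 0 i - d 0 (Ordinal r_lt)).
    by move=> closeL; apply: (truncation_gap (r := Ordinal r_lt) symG SXs opt rtr
      (ltW eta0) closeL).
  have [tM zM] := truncated_proj_gap pZ (gap _ closeM).
  have [tN zN] := truncated_proj_gap pX (gap _ closeN).
  by split.
have [symZ Kw] : (forall t, (1 <= t)%N -> symmetric_matrices R n (Z t.+1)) /\
    (forall t, (1 <= t)%N -> K (w t.+1)).
  by split=> t /(extrapolated_mem hiter) [[]].
have symZavg : Zavg^T = Zavg.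
  (* The zero function gives access to the membership half of [jensen_average]: the averaged matrix
     is symmetric. *)
  have conv0 : convex_function (symmetric_matrices R n) (fun=> 0 : R).
    by move=> l A B _ _ /=; rewrite convmm.
  by have [] := jensen_average (symmetric_matrices_convex (n := n)) conv0 symZ T1.
have S0 : spectrahedron R n !=set0 by exists Xs.
have [v Kv vmax] := max_over_compact dot_norm hgrad K0 Kcompact symZavg.
have [B SB Bmin] := min_over_spectrahedron dot_norm hgrad wavg S0.
exists (f Zavg v), (f B wavg); split.
- by split=> [|_ [u Ku <-]]; [exists v|exact: vmax].
- by split=> [|_ [A SA <-]]; [exists B|exact: Bmin].
have [SX1 Ky1 _] := hiter.
have := average_gap_le dot_norm Kconvex hgrad hconvex hconcave bX0 by0 bXy0 byX0
  hbX hby hbXy hbyX eta0 etaX etay hiter SB Kv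
  (pair_norm_le_diameter Kcompact SX1 SB Ky1 Kv) T1.
move/le_trans; apply; rewrite ler_wpM2r ?invr_ge0 // ler_wpM2l ?sqr_ge0 //.
(* Here [1 / (2 eta) = mu / 2], and halving each of the four terms of [mu] gives the maximum of the
   claimed bound. *)
rewrite /eta etaE invfM invrK mulrC ler_pdivrMr // mulrC.
rewrite /mu !ge_max.
set m := Num.max _ _.
have := lexx m; rewrite {1}/m !ge_max => /andP[/andP[m1 m2] /andP[m3 m4]].
by apply/andP; split; apply/andP; split; lra.
Qed.
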